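(* Let $X$ be a dendrite and $(\mathcal{E},\mathcal{F})$ a local resistance form on $X$ such that $(X,d_R)$ is compact, let $m$ be a finite energy dominant measure for $(\mathcal{E},\mathcal{F})$, and assume there exists a coordinate sequence for $(\mathcal{E},\mathcal{F})$ with respect to $m$. Then $d_{\Gamma,m}$ is a shortest path metric on $X$.
   Context: A dendrite is an arcwise connected topological space containing no subset homeomorphic to a circle; for $x,y$ in a dendrite there is a unique (up to reparametrization) path $\gamma_{x,y}:[0,1]\to X$ from $x$ to $y$. A metric $d$ on a dendrite is a shortest path metric if $d(x,y)=d(x,z)+d(z,y)$ for all $x,y$ and all $z\in\gamma_{x,y}([0,1])$. Resistance form $(\mathcal{E},\mathcal{F})$ on $X$: (RF1) $\mathcal{E}$ nonnegative definite symmetric bilinear on a vector space $\mathcal{F}$ of real functions, $\mathcal{E}(u)=0$ iff $u$ constant; (RF2) $(\mathcal{F}/\text{constants},\mathcal{E})$ Hilbert; (RF3) $\mathcal{F}$ separates points; (RF4) $d_R(x,y):=\sup\{|u(x)-u(y)|^2:\mathcal{E}(u)\le1\}<\infty$; (RF5) Markov property. Local means strongly local in the Dirichlet form sense. Energy measure: $\int\varphi\,d\Gamma(f)=\mathcal{E}(\varphi f,f)-\frac12\mathcal{E}(\varphi,f^2)$. Energy dominant $m$: full-support Borel measure with $\Gamma(f)\ll m$ for all $f\in\mathcal{F}$; $\Gamma(f)\le m$ means $d\Gamma(f)/dm\le1$ a.e. Coordinate sequence w.r.t. $m$: $(f_n)\subset\mathcal{F}$ with $\mathcal{E}_1$-dense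 span and $\Gamma(f_n)\le m$. $d_{\Gamma,m}(x,y)=\sup\{f(x)-f(y):f\in\mathcal{F},\ \Gamma(f)\le m\}$. *)

(* Defs.v *)
From HB Require Import structures.
From mathcomp Require Import all_boot all_order all_algebra.
From mathcomp Require Import all_classical all_reals all_analysis.
Set Implicit Arguments. Unset Strict Implicit. Unset Printing Implicit Defensive.
Import Order.TTheory GRing.Theory Num.Theory.
Local Open Scope classical_set_scope.
Local Open Scope ring_scope.

Section Defs.
Context {R : realType} {T : Type}.
Implicit Types (E : (T -> R) -> (T -> R) -> R) (F : set (T -> R)).

Definition cstfun (c : R) : T -> R := fun _ => c.

Definition RF1 E F :=
  [/\ (forall c, F (cstfun c)),
      (forall u v, F u -> F v -> F (u \+ v)),
      (forall (a : R) u, F u -> F (fun x => a * u x)),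
      (forall u v, F u -> F v -> E u v = E v u) &
  [/\
      (forall u v w, F u -> F v -> F w -> E (u \+ v) w = E u w + E v w),
      (forall (a : R) u v, F u -> F v -> E (fun x => a * u x) v = a * E u v),
      (forall u, F u -> 0 <= E u u) &
      (forall u, F u -> (E u u = 0 <-> exists c, u = cstfun c))]].

(* RF2: (F/constants, E) is a Hilbert space, i.e. it is complete. *)
Definition RF2 E F :=
  forall u : nat -> T -> R, (forall n, F (u n)) ->
    (forall e : R, 0 < e -> exists N, forall n k, (N <= n)%N -> (N <= k)%N ->
        E (u n \- u k) (u n \- u k) < e) ->
    exists2 v, F v &
      (forall e : R, 0 < e -> exists N, forall n, (N <= n)%N ->
        E (u n \- v) (u n \- v) < e).

Definition RF3 F := forall x y : T, x <> y -> exists2 u, F u & u x <> u y.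

Definition dR_sup E F (x y : T) : \bar R :=
  ereal_sup [set ((u x - u y) ^+ 2)%:E | u in [set u | F u /\ E u u <= 1]].

Definition RF4 E F := forall x y : T, (dR_sup E F x y < +oo)%E.

Definition unit_contraction (u : T -> R) : T -> R :=
  fun x => Num.min (Num.max (u x) 0) 1.

Definition RF5 E F := forall u, F u ->
  F (unit_contraction u) /\ E (unit_contraction u) (unit_contraction u) <= E u u.

Definition resistance_form E F := [/\ RF1 E F, RF2 E F, RF3 F, RF4 E F & RF5 E F].

Definition dR E F (x y : T) : R := fine (dR_sup E F x y).

Definition dR_open E F (U : set T) :=
  forall x, U x -> exists2 r : R, 0 < r & forall y, dR E F x y < r -> U y.

Definition dR_compact E F :=
  forall (I : Type) (U : I -> set T), (forall i, dR_open E F (U i)) ->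
    (forall x, exists i, U i x) ->
    exists2 J : set I, finite_set J & forall x, exists2 i, J i & U i x.

Definition dR_supp E F (u : T -> R) : set T :=
  [set x | forall r : R, 0 < r -> exists2 y, dR E F x y < r & u y <> 0].

Definition strongly_local E F :=
  forall u v, F u -> F v ->
    (exists c : R, exists2 U, dR_open E F U /\ dR_supp E F u `<=` U &
       forall x, U x -> v x = c) ->
    E u v = 0.

Definition cont_into E F (A : set R) (g : R -> T) :=
  forall t, A t -> forall e : R, 0 < e -> exists2 del : R, 0 < del &
    forall s, A s -> `|s - t| < del -> dR E F (g s) (g t) < e.

Definition arc E F (g : R -> T) (x y : T) :=
  [/\ cont_into E F [set t | 0 <= t <= 1] g, {in `[0, 1] &, injective g}, g 0 = x & g 1 = y].

Definition arcwise_connected E F :=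
  forall x y : T, x <> y -> exists g, arc E F g x y.

Definition circle : set (R * R) := [set p | p.1 ^+ 2 + p.2 ^+ 2 = 1].

Definition eucl_dist (p q : R * R) : R :=
  Num.sqrt ((p.1 - q.1) ^+ 2 + (p.2 - q.2) ^+ 2).

Definition homeomorphic_to_circle E F (S : set T) :=
  exists (f : R * R -> T) (g : T -> R * R),
  [/\ (forall p, circle p -> S (f p)), (forall x, S x -> circle (g x)),
      (forall p, circle p -> g (f p) = p) & (forall x, S x -> f (g x) = x)] /\
  [/\
      (forall p, circle p -> forall e : R, 0 < e -> exists2 del : R, 0 < del &
         forall q, circle q -> eucl_dist q p < del -> dR E F (f q) (f p) < e) &
      (forall x, S x -> forall e : R, 0 < e -> exists2 del : R, 0 < del &
         forall y, S y -> dR E F y x < del -> eucl_dist (g y) (g x) < e)].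

Definition dendrite E F :=
  arcwise_connected E F /\ ~ exists S, homeomorphic_to_circle E F S.

(* z lies on the (unique) arc gamma_{x,y}([0,1]) *)
Definition on_arc E F (x y z : T) :=
  z = x \/ z = y \/ exists2 g, arc E F g x y & exists2 t, 0 <= t <= 1 & g t = z.

Definition is_metric (D : T -> T -> R) :=
  [/\ (forall x y, 0 <= D x y), (forall x y, D x y = 0 <-> x = y),
      (forall x y, D x y = D y x) & (forall x y z, D x z <= D x y + D y z)].

Definition shortest_path_metric E F (D : T -> T -> R) :=
  is_metric D /\ forall x y z, on_arc E F x y z -> D x y = D x z + D z y.

End Defs.

Section MDefs.
Context {R : realType} {d : measure_display} {X : measurableType d}.
Implicit Types (E : (X -> R) -> (X -> R) -> R) (F : set (X -> R)).
Local Open Scope ereal_scope.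

Definition borel_dR E F :=
  forall A : set X, measurable A <-> <<s dR_open E F >> A.

Definition full_support E F (m : {measure set X -> \bar R}) :=
  forall U : set X, dR_open E F U -> U !=set0 -> 0 < m U.

Definition finite_measure_ (m : {measure set X -> \bar R}) := m setT < +oo.

Definition energy_measure E F (f : X -> R) (mu : {measure set X -> \bar R}) :=
  mu setT < +oo /\
  forall phi, F phi ->
    \int[mu]_x (phi x)%:E =
      (E (phi \* f) f - E phi (f \* f) / 2%:R)%R%:E.

Definition abs_cont (mu m : {measure set X -> \bar R}) :=
  forall A, measurable A -> m A = 0 -> mu A = 0.

Definition energy_dominant E F (m : {measure set X -> \bar R}) :=
  full_support E F m /\
  forall f, F f -> exists mu, energy_measure E F f mu /\ abs_cont mu m.

Definition Gamma_le E F (f : X -> R) (m : {measure set X -> \bar R}) :=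
  exists mu, energy_measure E F f mu /\ abs_cont mu m /\
    forall A, measurable A -> mu A <= m A.

Definition coordinate_sequence E F (m : {measure set X -> \bar R})
    (f : nat -> X -> R) :=
  [/\ forall n, F (f n),
      forall n, Gamma_le E F (f n) m &
      forall u, F u -> forall e : R, (0 < e)%R ->
        exists (N : nat) (c : nat -> R),
          let h := fun x => (u x - \sum_(i < N) c i * f i x)%R in
          (E h h)%:E + \int[m]_x ((h x) ^+ 2)%:E < e%:E].

Definition d_Gamma E F (m : {measure set X -> \bar R}) (x y : X) : \bar R :=
  ereal_sup [set (f x - f y)%R%:E | f in [set f | F f /\ Gamma_le E F f m]].

End MDefs.

(* Main.v *)
Require Import Defs.
From HB Require Import structures.
From mathcomp Require Import all_boot all_order all_algebra.
From mathcomp Require Import all_classical all_reals all_analysis.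
From mathcomp Require Import ring lra.
Import Order.TTheory GRing.Theory Num.Theory numFieldNormedType.Exports.
Local Open Scope classical_set_scope.
Local Open Scope ring_scope.

(** The distance [d = d_Gamma] is a geodesic metric inducing the topology of
[d_R], and a dendrite has only one arc between two points, so every arc is a
[d]-geodesic.

Topology: an admissible [f] ([Gamma f <= m]) has energy at most [m X], hence
[d <= sqrt (m X * d_R)], while the coordinate sequence makes [d] separate
points; compactness gives the equivalence of the two topologies.

Geodesics: [F] is an algebra and [Gamma] is local, so a function that coincides
up to constants with admissible functions on open sets covering [m]-almost all
of [X] is admissible.  Since [Gamma h << m] for all [h], this applies to
[max f (g + c)] as soon as [m {f - g = c} = 0], i.e. for all but countably many
[c].  Finite maxima and compactness then produce an admissible [f], nearly [0] at
[x], truncated at a level close to [r] and constant off the ball [B(x,r)]; if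
[B(x,r)] and [B(y,s)] are disjoint, the difference of two such functions is
admissible and shows [r + s <= d(x,y)].  So points at any intermediate pair of
distances from [x] and [y] exist, and a maximal subset of [X] that [d(x,.)]
embeds isometrically into [[0, d(x,y)]] is a geodesic from [x] to [y].

Uniqueness: a point of an arc lying off a geodesic with the same end points
gives an excursion of the arc which, closed up by a piece of the geodesic, is a
circle. *)

(** * Resistance forms on compact spaces *)

Section ResistanceForm.
Context {R : realType} {T : Type} {E : (T -> R) -> (T -> R) -> R}
  {F : set (T -> R)}.
Context (rf : resistance_form E F).

(** * Bilinear calculus of the form *)

Lemma formC u v : F u -> F v -> E u v = E v u.
Proof. by case: rf => -[_ _ _ h _] _ _ _ _; exact: h. Qed.

Lemma dom_cst c : F (fun=> c).
Proof. by case: rf => -[h _ _ _ _] _ _ _ _; exact: h. Qed.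

Lemma dom_lin (a b : R) u v : F u -> F v -> F (fun x => a * u x + b * v x).
Proof.
by case: rf => -[_ hD hZ _ _] _ _ _ _ Fu Fv; apply: (hD); apply: hZ.
Qed.

Lemma dom_scale (a : R) u : F u -> F (fun x => a * u x).
Proof. by case: rf => -[_ hD hZ _ _] _ _ _ _; exact: hZ. Qed.

Lemma dom_add u v : F u -> F v -> F (fun x => u x + v x).
Proof. by case: rf => -[_ hD hZ _ _] _ _ _ _; exact: hD. Qed.

Lemma dom_opp u : F u -> F (fun x => - u x).
Proof.
move=> Fu; rewrite (_ : (fun x => _) = (fun x => -1 * u x)); last first.
  by apply/funext => x; rewrite mulN1r.
exact: dom_scale.
Qed.

Lemma dom_sub u v : F u -> F v -> F (fun x => u x - v x).
Proof. by move=> Fu Fv; apply: dom_add => //; exact: dom_opp. Qed.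

Lemma dom_shift c u : F u -> F (fun x => u x + c).
Proof. by move=> Fu; apply: dom_add => //; exact: dom_cst. Qed.

Lemma form_lin (a b : R) u v w : F u -> F v -> F w ->
  E (fun x => a * u x + b * v x) w = a * E u w + b * E v w.
Proof.
case: (rf) => -[_ _ _ _ [hD hZ _ _]] _ _ _ _ Fu Fv Fw.
have := hD _ _ w (dom_scale a _ Fu) (dom_scale b _ Fv) Fw.
by rewrite !hZ.
Qed.

Lemma form_subr w u v : F w -> F u -> F v ->
  E w (fun x => u x - v x) = E w u - E w v.
Proof.
move=> Fw Fu Fv; rewrite (_ : (fun x => _) = (fun x => 1 * u x + (- 1) * v x)); last first.
  by apply/funext => x; rewrite mul1r mulN1r.
rewrite formC//; last exact: dom_lin.
by rewrite form_lin// mul1r mulN1r (formC u) ?(formC v).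
Qed.

Lemma form_ge0 u : F u -> 0 <= E u u.
Proof. by case: rf => -[_ _ _ _ [_ _ h _]] _ _ _ _; exact: h. Qed.

Lemma energy_lin (a b : R) u v : F u -> F v ->
  E (fun x => a * u x + b * v x) (fun x => a * u x + b * v x) =
  a ^+ 2 * E u u + 2 * a * b * E u v + b ^+ 2 * E v v.
Proof.
move=> Fu Fv; have Fuv := dom_lin a b _ _ Fu Fv.
rewrite form_lin// (formC _ _ Fu)// (formC _ _ Fv)// !form_lin//.
by rewrite (formC v u)//; ring.
Qed.

(** As [E c c = 0], the energy of [v] plus [a] times the constant is affine in [a]; being
    nonnegative, it has slope [0]. The coefficient [a] chosen here would give it the value [-1]. *)
Lemma form_cstl c v : F v -> E (fun=> c) v = 0.
Proof.
move=> Fv; have Fc := dom_cst c.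
have E0 : E (fun=> c) (fun=> c) = 0.
  case: (rf) => -[_ _ _ _ [_ _ _ h]] _ _ _ _.
  by apply/(h _ Fc); exists c.
apply/eqP/negPn/negP => n0.
have := form_ge0 _ (dom_lin (- (E v v + 1) / (2 * E (fun=> c) v)) 1 _ _ Fc Fv).
rewrite energy_lin// E0 (_ : _ + _ = - 1); first by rewrite ler0N1.
by field.
Qed.

Lemma form_cstr c v : F v -> E v (fun=> c) = 0.
Proof. by move=> Fv; rewrite formC ?form_cstl//; exact: dom_cst. Qed.

Lemma energy_scale (a : R) u : F u ->
  E (fun x => a * u x) (fun x => a * u x) = a ^+ 2 * E u u.
Proof.
move=> Fu; have := energy_lin a 0 _ _ Fu (dom_cst 0).
rewrite form_cstr ?form_cstl//; last exact: dom_cst.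
rewrite !mulr0 !addr0 => <-.
by congr E; apply/funext => x; rewrite ?mulr0 ?addr0.
Qed.

Lemma energy_shift (c : R) u : F u ->
  E (fun x => u x + c) (fun x => u x + c) = E u u.
Proof.
move=> Fu; have := energy_lin 1 1 _ _ Fu (dom_cst c).
rewrite form_cstr ?form_cstl//; last exact: dom_cst.
rewrite !mulr0 !addr0 expr1n !mul1r => <-.
by congr E; apply/funext => x; rewrite ?mul1r.
Qed.

(** * The resistance metric and its topology *)

Lemma dR_sup_ge0 x y : (0 <= dR_sup E F x y)%E.
Proof.
apply: ereal_sup_ubound; exists (fun=> 0) => /=.
  by split; [exact: dom_cst|rewrite form_cstl ?ler01//; exact: dom_cst].
by rewrite subrr expr0n.
Qed.

Lemma dR_supE x y : dR_sup E F x y = (dR E F x y)%:E.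
Proof.
rewrite /dR fineK// ge0_fin_numE; last exact: dR_sup_ge0.
by case: rf => _ _ _ h _; exact: h.
Qed.

Lemma dR_ge0 x y : 0 <= dR E F x y.
Proof. by rewrite -lee_fin -dR_supE; exact: dR_sup_ge0. Qed.

(** Scaling [u] to energy one gives a competitor in the supremum defining [dR]; a [u] of zero energy
    is constant. *)
Lemma sq_osc_le_energy u x y : F u -> (u x - u y) ^+ 2 <= dR E F x y * E u u.
Proof.
move=> Fu; have [/eqP E0|E0] := boolP (E u u == 0).
  case: (rf) => -[_ _ _ _ [_ _ _ h]] _ _ _ _.
  have /(h _ Fu) [c ->] := E0; rewrite subrr expr0n/= mulr_ge0 ?dR_ge0//.
  by rewrite form_ge0//; exact: dom_cst.
have Ep : 0 < E u u by rewrite lt_neqAle eq_sym E0 form_ge0.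
set s := Num.sqrt (E u u).
have sE : s ^+ 2 = E u u by rewrite sqr_sqrtr// ltW.
have sp : 0 < s by rewrite sqrtr_gt0.
have Fv := dom_scale s^-1 _ Fu.
have Ev : E (fun x => s^-1 * u x) (fun x => s^-1 * u x) <= 1.
  by rewrite energy_scale// exprVn sE mulVf// gt_eqF.
have : (((s^-1 * u x - s^-1 * u y) ^+ 2)%:E <= (dR E F x y)%:E)%E.
  by rewrite -dR_supE; apply: ereal_sup_ubound; exists (fun x => s^-1 * u x).
rewrite lee_fin -mulrBr exprMn exprVn sE => h.
by rewrite -ler_pdivrMr// mulrC.
Qed.

(** The square root is the scale on which energy bounds oscillations linearly, so that the triangle
    inequality passes through the supremum. *)
Definition res_dist x y : R := Num.sqrt (dR E F x y).

Lemma res_dist_ge0 x y : 0 <= res_dist x y.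
Proof. exact: sqrtr_ge0. Qed.

Lemma sqr_res_dist x y : res_dist x y ^+ 2 = dR E F x y.
Proof. by rewrite sqr_sqrtr// dR_ge0. Qed.

Lemma osc_le_energy u x y : F u ->
  `|u x - u y| <= res_dist x y * Num.sqrt (E u u).
Proof.
move=> Fu; rewrite -(sqrtr_sqr (u x - u y)) -sqrtrM ?dR_ge0//.
by rewrite ler_wsqrtr// sq_osc_le_energy.
Qed.

Lemma dR_sym x y : dR E F x y = dR E F y x.
Proof.
rewrite /dR /dR_sup; congr (fine (ereal_sup _)); apply/seteqP; split => _ [u Fu <-];
by exists u => //; rewrite -sqrrN opprB.
Qed.

Lemma res_distC x y : res_dist x y = res_dist y x.
Proof. by rewrite /res_dist dR_sym. Qed.

Lemma dRxx x : dR E F x x = 0.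
Proof.
apply/eqP; rewrite eq_le dR_ge0 andbT -lee_fin -dR_supE.
by apply: ge_ereal_sup => _ [u _ <-]; rewrite subrr expr0n.
Qed.

Lemma res_dist_triangle y x z : res_dist x z <= res_dist x y + res_dist y z.
Proof.
have p0 : 0 <= res_dist x y + res_dist y z by rewrite addr_ge0 ?res_dist_ge0.
rewrite -(@ler_pXn2r _ 2) ?nnegrE ?res_dist_ge0// sqr_res_dist.
rewrite -lee_fin -dR_supE; apply: ge_ereal_sup => _ [u [Fu Eu] <-].
rewrite lee_fin -(real_normK (num_real (u x - u z))) ler_pXn2r ?nnegrE//.
have s1 : Num.sqrt (E u u) <= 1 by rewrite -sqrtr1 ler_wsqrtr.
have h a b : `|u a - u b| <= res_dist a b.
  apply: le_trans (osc_le_energy _ a b Fu) _.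
  by rewrite ler_piMr// res_dist_ge0.
by rewrite (le_trans (ler_distD (u y) _ _))// lerD.
Qed.

Definition dR_continuous (u : T -> R) := forall x e, 0 < e ->
  exists2 r, 0 < r & forall y, dR E F x y < r -> `|u x - u y| < e.

Lemma res_dist_lt x y r : 0 < r -> dR E F x y < r ^+ 2 -> res_dist x y < r.
Proof.
move=> r0; rewrite -sqr_res_dist ltr_pXn2r// nnegrE ?res_dist_ge0//.
exact: ltW.
Qed.

Lemma lipschitz_continuous (C : R) u :
  (forall x y, `|u x - u y| <= res_dist x y * C) -> dR_continuous u.
Proof.
move=> h x e e0.
have C1 : 0 < `|C| + 1 by rewrite ltr_wpDl.
exists ((e / (`|C| + 1)) ^+ 2); first by rewrite exprn_gt0// divr_gt0.
move=> y /(res_dist_lt _ _ _ (divr_gt0 e0 C1)) xy.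
apply: le_lt_trans (h x y) _; rewrite ltr_pdivlMr// in xy.
apply: le_lt_trans xy; rewrite ler_wpM2l ?res_dist_ge0//.
by rewrite (le_trans (ler_norm _))// lerDl.
Qed.

Lemma dom_continuous u : F u -> dR_continuous u.
Proof.
by move=> Fu; apply: (lipschitz_continuous (Num.sqrt (E u u))) => x y; exact: osc_le_energy.
Qed.

Lemma res_dist_continuous x : dR_continuous (res_dist x).
Proof.
apply: (lipschitz_continuous 1) => y z; rewrite mulr1 ler_norml.
have := res_dist_triangle z x y; have := res_dist_triangle y x z.
by rewrite (res_distC z y); lra.
Qed.

Lemma gt_open u a : dR_continuous u -> dR_open E F [set x | a < u x].
Proof.
move=> cu x /= ax; have [r r0 h] := cu x (u x - a) ltac:(by rewrite subr_gt0).
by exists r => // y /h /=; rewrite ltr_norml; lra.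
Qed.

Lemma continuous_opp u : dR_continuous u -> dR_continuous (fun x => - u x).
Proof.
move=> cu x e /(cu x)[r r0 h]; exists r => // y /h.
by rewrite -opprD normrN.
Qed.

Lemma lt_open u a : dR_continuous u -> dR_open E F [set x | u x < a].
Proof.
move=> /continuous_opp/gt_open -/(_ (- a)); congr dR_open.
by apply/seteqP; split => x /=; rewrite ltrN2.
Qed.

Lemma openU A B : dR_open E F A -> dR_open E F B -> dR_open E F (A `|` B).
Proof.
by move=> oA oB x [/oA|/oB] [r r0 h]; exists r => // y /h; [left|right].
Qed.

Lemma openI A B : dR_open E F A -> dR_open E F B -> dR_open E F (A `&` B).
Proof.
move=> oA oB x [/oA[r r0 h] /oB[s s0 k]].
exists (Num.min r s); first by rewrite lt_min r0 s0.
by move=> y; rewrite lt_min => /andP[/h ? /k ?].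
Qed.

(** * Compactness and lattice operations *)

Context (cpt : dR_compact E F).

Lemma compact_nat_cover (U : nat -> set T) : (forall n, dR_open E F (U n)) ->
  (forall n k, (n <= k)%N -> U n `<=` U k) -> (forall x, exists n, U n x) ->
  exists n, forall x, U n x.
Proof.
move=> oU mU cU; have [J fJ cJ] := cpt _ _ oU cU.
have /finite_seqP[l Jl] := fJ.
exists (\max_(i <- l) i)%N => x; have [i Ji Ui] := cJ x.
by apply: mU Ui; move: Ji; rewrite Jl => il; exact: leq_bigmax_seq.
Qed.

Lemma continuous_bounded u : dR_continuous u -> exists2 M, 0 < M & forall x, `|u x| < M.
Proof.
move=> cu.
have := compact_nat_cover (fun n => [set x | - n%:R < u x] `&` [set x | u x < n%:R]).
case.
- by move=> n; apply: openI; [exact: gt_open|exact: lt_open].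
- move=> n k nk x [/= h1 h2]; have : n%:R <= k%:R :> R by rewrite ler_nat.
  by move=> nk'; split => /=; lra.
- move=> x; exists (Num.bound (u x)) => /=; have := archi_boundP (normr_ge0 (u x)).
  rewrite (_ : Num.bound `|u x| = Num.bound (u x)); last by rewrite /Num.bound normr_id.
  by rewrite ltr_norml => /andP[].
move=> n h; exists (n%:R + 1); first by rewrite ltr_wpDl.
by move=> x; have [/= h1 h2] := h x; rewrite ltr_norml; apply/andP; split; lra.
Qed.

(** The Markov property cuts at [0] and at [1]. A bound [M] of [|u|], available by compactness,
    makes the cut at [1] idle after division by [M]. *)
Lemma pos_part u : F u -> F (fun x => Num.max (u x) 0) /\
  E (fun x => Num.max (u x) 0) (fun x => Num.max (u x) 0) <= E u u.
Proof.
move=> Fu; have [M M0 uM] := continuous_bounded _ (dom_continuous _ Fu).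
have FM := dom_scale M^-1 _ Fu.
have [_ _ _ _ /(_ _ FM)[Fc Ec]] := rf.
have eqc : (fun x => Num.max (u x) 0) =
    (fun x => M * unit_contraction (fun x => M^-1 * u x) x).
  apply/funext => x; rewrite /unit_contraction.
  rewrite min_l; last first.
    rewrite ge_max ler01 andbT ler_pdivrMl// mulr1.
    by rewrite (le_trans (ler_norm _))// ltW.
  by rewrite maxr_pMr ?mulr0 1?ltW// mulrA divff ?mul1r// gt_eqF.
rewrite eqc; split; first exact: dom_scale.
rewrite energy_scale//; apply: le_trans (ler_wpM2l (sqr_ge0 M) Ec) _.
by rewrite energy_scale// mulrA -exprMn divff ?lt0r_neq0// expr1n mul1r.
Qed.

Lemma dom_max u v : F u -> F v -> F (fun x => Num.max (u x) (v x)).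
Proof.
move=> Fu Fv; have := dom_add _ _ (pos_part _ (dom_sub _ _ Fu Fv)).1 Fv.
congr F; apply/funext => x; have [h|h] := leP (u x) (v x).
  by rewrite max_r ?add0r// subr_le0.
by rewrite max_l ?subrK// subr_ge0 ltW.
Qed.

Lemma dom_min u v : F u -> F v -> F (fun x => Num.min (u x) (v x)).
Proof.
move=> Fu Fv; have := dom_opp _ (dom_max _ _ (dom_opp _ Fu) (dom_opp _ Fv)).
by congr F; apply/funext => x; rewrite oppr_max !opprK.
Qed.

(* Perturbing [u^+] by [- t u^-] leaves its positive part unchanged, so [u^+]
   minimizes the energy along this half-line. *)
Lemma form_pos_neg_le0 u : F u ->
  E (fun x => Num.max (u x) 0) (fun x => Num.max (- u x) 0) <= 0.
Proof.
move=> Fu; have [Fp _] := pos_part _ Fu.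
have [Fn _] := pos_part _ (dom_opp _ Fu).
set p := fun x => Num.max (u x) 0 in Fp *.
set n := fun x => Num.max (- u x) 0 in Fn *.
rewrite leNgt; apply/negP => pn0.
have En := form_ge0 _ Fn.
pose t := E p n / (E n n + 1).
have n1 : 0 < E n n + 1 by rewrite ltr_wpDl.
have t0 : 0 < t by rewrite divr_gt0.
have tE : t * E n n <= E p n.
  by rewrite mulrAC ler_pdivrMr// ler_wpM2l ?ltW// ltrDl.
have := (pos_part _ (dom_lin 1 (- t) _ _ Fp Fn)).2.
rewrite energy_lin//.
have -> : (fun x => Num.max (1 * p x + - t * n x) 0) = p.
  apply/funext => x; rewrite /p /n mul1r mulNr.
  have [u0|u0] := leP 0 (u x).
    by rewrite (max_r (_ : - u x <= 0)) ?oppr_le0// mulr0 subr0 !max_l.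
  rewrite (max_l (_ : 0 <= - u x)) ?oppr_ge0 1?ltW// add0r max_r//.
  by rewrite mulrN opprK pmulr_rle0// ltW.
nra.
Qed.

(** For the positive and negative parts [p] and [n], the energies of [p + n] and [p - n] differ by
    [4 * E p n], which is at most [0]. *)
Lemma energy_abs u : F u ->
  F (fun x => `|u x|) /\ E (fun x => `|u x|) (fun x => `|u x|) <= E u u.
Proof.
move=> Fu; have [Fp _] := pos_part _ Fu.
have [Fn _] := pos_part _ (dom_opp _ Fu).
have pn := form_pos_neg_le0 _ Fu.
set p := fun x => Num.max (u x) 0 in Fp pn *.
set n := fun x => Num.max (- u x) 0 in Fn pn *.
have -> : (fun x => `|u x|) = (fun x => 1 * p x + 1 * n x).
  apply/funext => x; rewrite /p /n !mul1r; have [u0|u0] := leP 0 (u x).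
    by rewrite ger0_norm// max_r ?addr0// oppr_le0.
  by rewrite ltr0_norm// max_l ?add0r// oppr_ge0 ltW.
have {1 2}-> : u = (fun x => 1 * p x + (- 1) * n x).
  apply/funext => x; rewrite /p /n mul1r mulN1r; have [u0|u0] := leP 0 (u x).
    by rewrite max_r ?subr0// oppr_le0.
  by rewrite max_l ?add0r ?opprK// oppr_ge0 ltW.
split; first exact: dom_lin.
by rewrite !energy_lin//; nra.
Qed.

(** * The domain is an algebra *)

(** Near-minimizers of the energy over the shrinking convex sets [K n] of functions close to [u]
    form a Cauchy sequence by the parallelogram law. Completeness gives a limit [w], and [u - w] is
    constant because energy controls oscillations. *)
Lemma dom_uniform_limit u C :
  (forall e, 0 < e -> exists2 v, F v /\ E v v <= C & forall x, `|v x - u x| <= e) ->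
  F u.
Proof.
move=> H.
pose K n := [set v | F v /\ forall x, `|v x - u x| <= n.+1%:R^-1].
pose S n := [set E v v | v in K n].
have inv0 n : 0 < n.+1%:R^-1 :> R by rewrite invr_gt0 ltr0n.
have lbS n : lbound (S n) 0 by move=> _ [v [Fv _] <-]; exact: form_ge0.
have hiS n : has_inf (S n).
  split; last by exists 0.
  by have [v [Fv _] h] := H _ (inv0 n); exists (E v v), v.
pose a n := inf (S n).
have aC n : a n <= C.
  have [v [Fv vC] h] := H _ (inv0 n); apply: le_trans vC.
  by apply: ge_inf; [exists 0|exists v].
have KK n k : (n <= k)%N -> K k `<=` K n.
  move=> nk v [Fv h]; split => // x; apply: le_trans (h x) _.
  by rewrite lef_pV2 ?posrE ?ltr0n// ler_nat.
have aK n v : K n v -> a n <= E v v.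
  by move=> Kv; apply: ge_inf; [exists 0|exists v].
have aL n k : (n <= k)%N -> a n <= a k.
  move=> nk; apply: lb_le_inf; first by have [] := hiS k.
  by move=> _ [v Kv <-]; apply: aK; exact: KK Kv.
have ha : has_sup (range a).
  by split; [exists (a 0%N), 0%N|exists C => _ [n _ <-]].
have /choice[v hv] : forall n, exists v, K n v /\ E v v < a n + n.+1%:R^-1.
  move=> n; have [_ [v Kv <-] h] := inf_adherent (inv0 n) (hiS n).
  by exists v.
pose L := sup (range a).
have aLL n : a n <= L by apply: ub_le_sup; [case: ha|exists n].
have Kmid n w w' : K n w -> K n w' -> K n (fun x => 2^-1 * w x + 2^-1 * w' x).
  move=> [Fw hw] [Fw' hw']; split; first exact: dom_lin.
  move=> x; move: (hw x) (hw' x); rewrite !ler_norml; move: n.+1%:R^-1 => q; lra.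
have [_ /(_ v) h _ _ _] := rf; case: h.
- by move=> n; have [[]] := hv n.
(* The midpoint lies in [K N0], so by the parallelogram law the energy of [v n - v k] is below
   [4 * (L + e / 8) - 4 * (L - e / 8) = e]. *)
- move=> e e0; have e8 : 0 < e / 8 by rewrite divr_gt0.
  have [_ [N0 _ <-] hN0] := sup_adherent e8 ha.
  have [N1 _ hN1] := near_infty_natSinv_lt (PosNum e8).
  exists (maxn N0 N1) => n k; rewrite !geq_max => /andP[n0 n1] /andP[k0 k1].
  have [Kn En] := hv n; have [Kk Ek] := hv k.
  have Km := aK _ _ (Kmid N0 _ _ (KK _ _ n0 _ Kn) (KK _ _ k0 _ Kk)).
  have [Fn _] := Kn; have [Fk _] := Kk.
  have hn : n.+1%:R^-1 < e / 8 by exact: (hN1 n n1).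
  have hk : k.+1%:R^-1 < e / 8 by exact: (hN1 k k1).
  rewrite (_ : v n \- v k = fun x => 1 * v n x + (- 1) * v k x); last first.
    by apply/funext => x /=; rewrite mul1r mulN1r.
  have {}En : E (v n) (v n) < a n + e / 8 by rewrite (lt_trans En)// ltrD2l.
  have {}Ek : E (v k) (v k) < a k + e / 8 by rewrite (lt_trans Ek)// ltrD2l.
  move: Km; rewrite !energy_lin//.
  have := aLL n; have := aLL k; rewrite -/L in hN0; lra.
move=> w Fw hw.
have uw x y : u x - u y = w x - w y.
  pose D := `|u x - u y - (w x - w y)|.
  apply/eqP; rewrite -subr_eq0 -normr_eq0 -/D; apply/negPn/negP => D0.
  have {}D0 : 0 < D by rewrite lt_neqAle eq_sym D0 normr_ge0.
  have r1 : 0 < 4 * (res_dist x y + 1) by rewrite mulr_gt0// ltr_wpDl// res_dist_ge0.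
  (* With this [e] the oscillation of [v n - w] is at most [D / 4]; two uniform errors of [D / 8]
     then give [D <= D / 2]. *)
  set e := D / (4 * (res_dist x y + 1)).
  have e0 : 0 < e by rewrite divr_gt0.
  have D8 : 0 < D / 8 by rewrite divr_gt0.
  have [N hN] := hw (e ^+ 2) ltac:(by rewrite exprn_gt0).
  have [N1 _ hN1] := near_infty_natSinv_lt (PosNum D8).
  pose n := maxn N N1.
  have [[Fn hn] _] := hv n.
  have En := hN n (leq_maxl _ _).
  have n1 : n.+1%:R^-1 < D / 8 by exact: (hN1 n (leq_maxr _ _)).
  have Fd := dom_sub _ _ Fn Fw.
  have o := osc_le_energy _ x y Fd.
  have sE : Num.sqrt (E (v n \- w) (v n \- w)) <= e.
    by rewrite -(ger0_norm (ltW e0)) -sqrtr_sqr ler_wsqrtr// ltW.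
  have oo : res_dist x y * Num.sqrt (E (v n \- w) (v n \- w)) <= D / 4.
    apply: le_trans (ler_wpM2l (res_dist_ge0 x y) sE) _.
    by rewrite /e mulrA ler_pdivrMr//; nra.
  have hn' z := le_trans (hn z) (ltW n1).
  have := le_trans o oo; move: (hn' x) (hn' y); rewrite !ler_norml.
  have : D = u x - u y - (w x - w y) \/ D = - (u x - u y - (w x - w y)).
    by rewrite /D; case: ler0P => _; [right|left].
  lra.
have [x0|nx] := pselect (exists x0 : T, True); last first.
  by rewrite (_ : u = w)//; apply/funext => x; exfalso; apply: nx; exists x.
case: x0 => x0 _; rewrite (_ : u = fun x => w x + (u x0 - w x0)); first exact: dom_shift.
by apply/funext => x; have := uw x x0; lra.
Qed.

(* The parabola [x - x^2] is a fixed point of [g |-> (t + g \o t) / 4], where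
   [t x = 1 - |2 x - 1|] is the tent map, which multiplies energies by at most 4. *)
Lemma parabola_approx n u : F u -> (forall x, 0 <= u x <= 1) ->
  exists2 v, F v /\ E v v <= E u u &
    forall x, `|v x - (u x - u x ^+ 2)| <= 4^-1 ^+ n.
Proof.
elim: n u => [|n IH] u Fu u01.
  have F0 := dom_cst 0; exists (fun=> 0); first by rewrite form_cstl ?form_ge0.
  by move=> x; have := u01 x; rewrite expr0 sub0r normrN ler_norml => h; apply/andP; split; nra.
have F1 := dom_shift (- 1) _ (dom_scale 2 _ Fu).
have [Fa Ea] := energy_abs _ F1.
rewrite energy_shift ?energy_scale// in Ea; last exact: dom_scale.
have Ft := dom_shift 1 _ (dom_scale (-1) _ Fa).
set t := (fun x => _) in Ft.
have Et : E t t <= 4 * E u u.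
  by rewrite energy_shift ?energy_scale//; [lra|exact: dom_scale].
have t01 x : 0 <= t x <= 1.
  rewrite /t; have := u01 x; have := normr_ge0 (2 * u x + - 1).
  have := ler_norml (2 * u x + - 1) 1 => e.
  have : `|2 * u x + - 1| <= 1 by rewrite e; have := u01 x; lra.
  lra.
have [v [Fv Ev] hv] := IH t Ft t01.
exists (fun x => 4^-1 * t x + 4^-1 * v x).
  split; first exact: dom_lin.
  (* Nonnegativity of the energy of [t - v] bounds the cross term, so the new function has energy at
     most [(E t t + E v v) / 8], hence at most [E u u]. *)
  have := form_ge0 _ (dom_lin 1 (-1) _ _ Ft Fv).
  by rewrite !energy_lin//; lra.
move=> x; have := hv x.
have -> : u x - u x ^+ 2 = 4^-1 * (t x + (t x - t x ^+ 2)).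
  rewrite /t; have : `|2 * u x + - 1| ^+ 2 = (2 * u x + - 1) ^+ 2 by rewrite real_normK ?num_real.
  set q := `|_| => hq; rewrite (_ : (-1 * q + 1) ^+ 2 = q ^+ 2 - 2 * q + 1); last by ring.
  by rewrite hq; field.
rewrite [4^-1 ^+ n.+1]exprS !ler_norml; move: (4^-1 ^+ n) => q; lra.
Qed.

(** An affine change brings [u] to a function [g] with values in [[0, 1]], for which [g - g^2] is a
    uniform limit of functions of energy at most [E g g]. Products then follow by polarization. *)
Lemma dom_sqr u : F u -> F (fun x => u x ^+ 2).
Proof.
move=> Fu; have [M M0 uM] := continuous_bounded _ (dom_continuous _ Fu).
pose g x := (2 * M)^-1 * u x + 2^-1.
have Fg : F g by apply: dom_shift; exact: dom_scale.
have g01 x : 0 <= g x <= 1.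
  have := uM x; rewrite ltr_norml /g invfM -mulrA => /andP[h1 h2].
  have a1 : -1 <= M^-1 * u x by rewrite ler_pdivlMl//; lra.
  have a2 : M^-1 * u x <= 1 by rewrite ler_pdivrMl//; lra.
  by apply/andP; split; lra.
have Ft : F (fun x => g x - g x ^+ 2).
  apply: (@dom_uniform_limit _ (E g g)) => e e0.
  have [n hn] : exists n, 4^-1 ^+ n <= e :> R.
    have [n _ /(_ n (leqnn _)) h] := near_infty_natSinv_lt (PosNum e0).
    exists n; apply: le_trans (ltW h); rewrite exprVn lef_pV2 ?posrE ?exprn_gt0//.
    by rewrite -natrX ler_nat ltn_expl.
  have [v hv hn'] := parabola_approx n _ Fg g01.
  by exists v => // x; apply: le_trans (hn' x) hn.
have := dom_add _ _ (dom_scale (M ^+ 2) _ (dom_lin 4 (-4) _ _ Fg Ft))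
  (dom_shift (M ^+ 2) _ (dom_scale (- (4 * M ^+ 2)) _ Fg)).
congr F; apply/funext => x; rewrite /g; field.
by rewrite gt_eqF.
Qed.

Lemma dom_mul u v : F u -> F v -> F (fun x => u x * v x).
Proof.
move=> Fu Fv.
have := dom_sub _ _ (dom_scale 2^-1 _ (dom_sqr _ (dom_add _ _ Fu Fv)))
  (dom_lin 2^-1 2^-1 _ _ (dom_sqr _ Fu) (dom_sqr _ Fv)).
by congr F; apply/funext => x; field.
Qed.

(** * Separation by functions of the domain *)

(** Finitely many of the sets [{a < u}] cover the compact set [K], and the maximum of the
    corresponding functions is again in [Q]. *)
Lemma cover_max (Q : set (T -> R)) (K : set T) (a : R) :
  dR_open E F (~` K) -> Q !=set0 -> (forall u, Q u -> dR_continuous u) ->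
  (forall u v, Q u -> Q v -> Q (fun x => Num.max (u x) (v x))) ->
  (forall x, K x -> exists2 u, Q u & a < u x) ->
  exists2 u, Q u & forall x, K x -> a < u x.
Proof.
move=> oK [u0 Q0] cQ mQ hK.
(* All functions serve as indices, so membership in [Q] is written into the sets; the complement of
   [K] joins each of them. *)
have [] := cpt _ (fun u => [set x | Q u /\ (~ K x \/ a < u x)]).
- move=> u x [Qu []] /=.
    by move=> /oK[r r0 h]; exists r => // y /h ?; split => //; left.
  move=> /(gt_open _ _ (cQ _ Qu) x)[r r0 h]; exists r => // y /h ?.
  by split => //; right.
- move=> x; have [Kx|nKx] := pselect (K x); last by exists u0; split => //; left.
  by have [u Qu ux] := hK x Kx; exists u; split => //; right.
move=> J /finite_seqP[l ->] hl.
have [u Qu hu] : exists2 u, Q u & forall v, v \in l -> Q v -> forall x, v x <= u x.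
  elim: l {hl} => [|w l [u Qu hu]]; first by exists u0.
  have [Qw|nQw] := pselect (Q w); last first.
    exists u => // v; rewrite inE => /orP[/eqP ->//|]; exact: hu.
  exists (fun x => Num.max (w x) (u x)); first exact: mQ.
  move=> v; rewrite inE => /orP[/eqP -> _ x|vl Qv x].
    by rewrite le_max lexx.
  by rewrite le_max (hu v vl Qv x) orbT.
exists u => // x Kx; have [v /= vl [Qv [//|av]]] := hl x.
exact: lt_le_trans av (hu v vl Qv x).
Qed.

(** [cover_max] yields a function at most [0] at [p] and above [1] off [O], which is then subtracted
    from [1]. *)
Lemma separate_point p O : dR_open E F O -> O p ->
  exists2 u, F u & 0 < u p /\ forall x, ~ O x -> u x < 0.
Proof.
move=> oO Op.
have [] := cover_max [set u | F u /\ u p <= 0] (~` O) 1.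
- by rewrite setCK.
- by exists (fun=> 0); split => //; exact: dom_cst.
- by move=> u [/dom_continuous].
- move=> u v [Fu up] [Fv vp]; split; first exact: dom_max.
  by rewrite ge_max up vp.
- move=> x nOx; have px : p <> x by move=> px; rewrite px in Op.
  have [_ _ /(_ _ _ px)[u Fu /eqP upx] _ _] := rf.
  (* The affine image of [u] with value [0] at [p] and [2] at [x]. *)
  exists (fun y => (2 / (u x - u p)) * u y + (- (2 / (u x - u p) * u p))).
    split; first by apply: dom_shift; exact: dom_scale.
    by rewrite subrr.
  rewrite -mulrBr divfK ?ltr1n// subr_eq0 eq_sym//.
move=> u [Fu up] hu; exists (fun x => - 1 * u x + 1).
  by apply: dom_shift; exact: dom_scale.
by split => [|x /hu]; lra.
Qed.

Lemma separate_closed K O : dR_open E F (~` K) -> dR_open E F O -> K `<=` O ->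
  exists2 u, F u & (forall x, K x -> 0 < u x) /\ (forall x, ~ O x -> u x <= 0).
Proof.
move=> oK oO KO.
have [] := cover_max [set u | F u /\ forall x, ~ O x -> u x <= 0] K 0.
- by [].
- by exists (fun=> 0); split => //; exact: dom_cst.
- by move=> u [/dom_continuous].
- move=> u v [Fu up] [Fv vp]; split; first exact: dom_max.
  by move=> x Ox; rewrite ge_max up// vp.
- move=> x /KO Ox; have [u Fu [ux h]] := separate_point _ _ oO Ox.
  by exists u => //; split => // y /h /ltW.
by move=> u [Fu h] h'; exists u.
Qed.

End ResistanceForm.

(** * Energy measures and the intrinsic metric *)

Section EnergyMeasure.
Context {R : realType} {d : measure_display} {X : measurableType d}
  {E : (X -> R) -> (X -> R) -> R} {F : set (X -> R)}.
Context (rf : resistance_form E F).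
Context (cpt : dR_compact E F).
Context (bor : borel_dR E F).

(** * Borel sets and measures tested on cutoffs *)

Lemma open_measurable_dR U : dR_open E F U -> measurable U.
Proof. by move=> oU; apply/bor; exact: sub_sigma_algebra. Qed.

Lemma continuous_measurable u : dR_continuous u (E := E) (F := F) -> measurable_fun setT u.
Proof.
move=> cu; apply: (measurability _ (measurable_realfun.RGenOInfty.measurableE R)).
move=> _ [_ [a ->] <-]; rewrite setTI; apply: open_measurable_dR.
rewrite (_ : _ @^-1` _ = [set x | a < u x]); first exact: gt_open.
by apply/seteqP; split => x /=; rewrite in_itv/= andbT.
Qed.

Lemma dom_measurable u : F u -> measurable_fun setT u.
Proof. by move=> Fu; apply: continuous_measurable; exact: dom_continuous. Qed.

(** A pi-system generating the Borel sets, on which finite measures are compared. *)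
Definition dom_pos : set (set X) :=
  [set A | exists2 w, F w & A = [set x | 0 < w x]].

Lemma dom_posE w : F w -> dom_pos [set x | 0 < w x].
Proof. by move=> Fw; exists w. Qed.

(** The closed sets [K n] of points at distance at least [n.+1%:R^-1] from the complement of [U]
    exhaust [U]. A function separating [K n] from that complement has its positivity set between
    [K n] and [U]. *)
Lemma open_bigcup_dom_pos U : dR_open E F U -> exists A : (set X)^nat,
  (forall n, dom_pos (A n)) /\ U = \bigcup_n A n.
Proof.
move=> oU; pose K n :=
  [set x | forall y, ~ U y -> n.+1%:R^-1 <= res_dist x y (E := E) (F := F)].
have KU n : K n `<=` U.
  move=> x Kx; apply: contrapT => /Kx.
  by rewrite /res_dist (dRxx rf) sqrtr0 leNgt invr_gt0 ltr0n.
have oK n : dR_open E F (~` K n).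
  move=> x /existsNP[y /not_implyP[Uy /negP]]; rewrite -ltNge => xy.
  have := lt_open _ n.+1%:R^-1 (res_dist_continuous rf y) x.
  rewrite /= res_distC => /(_ xy)[r r0 h]; exists r => // z /h /=.
  by rewrite res_distC => yz Kz; have := Kz y Uy; rewrite leNgt yz.
have /choice[w hw] : forall n, exists w, F w /\ (forall x, K n x -> 0 < w x) /\
    (forall x, ~ U x -> w x <= 0).
  by move=> n; have [w ? ?] := separate_closed rf cpt _ _ (oK n) oU (KU n); exists w.
exists (fun n => [set x | 0 < w n x]); split.
  by move=> n; apply: dom_posE; case: (hw n).
apply/seteqP; split => [x Ux|x [n _ /= wx]]; last first.
  apply: contrapT => /(proj2 (proj2 (hw n))); rewrite leNgt => /negP; exact.
have [r r0 h] := oU x Ux.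
have sr : 0 < Num.sqrt r by rewrite sqrtr_gt0.
have [n _ /(_ n (leqnn _)) nr] := near_infty_natSinv_lt (PosNum sr).
exists n => //=; apply: (proj1 (proj2 (hw n))) => y Uy.
rewrite leNgt; apply/negP => xy; apply: Uy; apply: h.
have := lt_trans xy nr; rewrite /= /res_dist ltr_sqrt//.
Qed.

Lemma measurable_dom_pos : @measurable d X = <<s dom_pos >>.
Proof.
apply/seteqP; split => A.
  move=> /bor; apply: smallest_sub; first exact: smallest_sigma_algebra.
  move=> U /open_bigcup_dom_pos[B [hB ->]].
  by apply: sigma_algebra_bigcup => n; exact: sub_sigma_algebra.
rewrite bor; apply: sub_sigma_algebra2 => _ [w Fw ->].
by apply: gt_open => //; exact: dom_continuous.
Qed.

Lemma dom_pos_setI : setI_closed dom_pos.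
Proof.
move=> _ _ [v Fv ->] [w Fw ->]; exists (fun x => Num.min (v x) (w x)).
  exact: (dom_min rf cpt).
by apply/seteqP; split => x /=; rewrite lt_min => /andP.
Qed.

Lemma pos_measurable w : F w -> measurable [set x | 0 < w x].
Proof. by move=> Fw; apply: open_measurable_dR; apply: gt_open; exact: dom_continuous. Qed.

(* The last clause puts the closed support of [phi] inside [{u > 0}]. *)
Definition cutoff (u phi : X -> R) :=
  [/\ F phi, (forall x, 0 <= phi x <= 1) &
      exists2 e, 0 < e & forall x, u x < e -> phi x = 0].

(** The indicator of the intersection of [{w > 0}] and [{u > 0}] is a bounded pointwise limit of
    cutoffs. By dominated convergence the restricted measures agree on the pi-system, hence on all
    Borel sets. *)
Lemma cutoff_integral_unique (mu nu : {measure set X -> \bar R}) u :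
  (mu setT < +oo)%E -> (nu setT < +oo)%E -> F u ->
  (forall phi, cutoff u phi -> \int[mu]_x (phi x)%:E = \int[nu]_x (phi x)%:E)%E ->
  forall A, measurable A -> mu (A `&` [set x | 0 < u x]) = nu (A `&` [set x | 0 < u x]).
Proof.
move=> muoo nuoo Fu H A mA; have mU := pos_measurable _ Fu.
apply: (measure_unique dom_pos (fun=> setT) measurable_dom_pos dom_pos_setI _ _
  (mrestr mu mU) (mrestr nu mU)) => //.
- by move=> _; exists (fun=> 1); [exact: (dom_cst rf)|apply/seteqP; split => x //=; rewrite ltr01].
- by apply/seteqP; split => // x _; exists 0%N.
- move=> _ [w Fw ->]; rewrite /= /mrestr.
  pose W x := Num.min (w x) (u x).
  have FW : F W by exact: (dom_min rf cpt).
  rewrite (_ : _ `&` _ = [set x | 0 < W x]); last first.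
    by apply/seteqP; split => x /=; rewrite lt_min => /andP.
  (* This is [0] where [W <= k.+1%:R^-1] and [1] where [W >= 2 / k.+1%:R]; it is a cutoff for [u]
     because [W <= u]. *)
  pose phi k := unit_contraction (fun x => k.+1%:R * W x + (- 1)).
  have Fphi k : F (phi k).
    have [_ _ _ _ h5] := rf; apply: (h5 _ _).1.
    by apply: (dom_shift rf) => //; exact: (dom_scale rf).
  have phi01 k x : 0 <= phi k x <= 1.
    by rewrite /phi /unit_contraction le_min ler01 le_max lexx orbT/= ge_min lexx orbT.
  have phicut k : cutoff u (phi k).
    split => //; exists k.+1%:R^-1; first by rewrite invr_gt0.
    move=> x ux; rewrite /phi /unit_contraction max_r ?min_l ?ler01//.
    rewrite subr_le0 -ler_pdivlMl// mulr1 (le_trans _ (ltW ux))//.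
    by rewrite ge_min lexx orbT.
  have phicvg x : (phi k x)%:E @[k --> \oo] --> (\1_[set x | 0 < W x] x)%:E.
    apply: (@cvg_near_cst _ _ _ _ _ _).
    have [W0|W0] := ltP 0 (W x); last first.
      near=> k; rewrite indicE memNset/=; last by rewrite ltNge W0.
      rewrite /phi /unit_contraction max_r ?min_l ?ler01//.
      by rewrite subr_le0 (le_trans _ ler01)// mulr_ge0_le0.
    have W2 : 0 < W x / 2 by rewrite divr_gt0.
    have [N _ hN] := near_infty_natSinv_lt (PosNum W2).
    exists N => // k /= Nk; rewrite indicE mem_set//.
    have {hN} := hN k Nk; rewrite /= => hk.
    have : 2 < k.+1%:R * W x.
      have : k.+1%:R * k.+1%:R^-1 < k.+1%:R * (W x / 2) by rewrite ltr_pM2l.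
      by rewrite divff// mulrA ltr_pdivlMr// mul1r.
    by move=> k2; rewrite /phi /unit_contraction min_r// le_max; apply/orP; left; lra.
  have key (l : {measure set X -> \bar R}) : (l setT < +oo)%E ->
      (\int[l]_x (phi k x)%:E)%E @[k --> \oo] --> l [set x | 0 < W x].
    move=> loo; have := @dominated_cvg _ _ _ l setT measurableT
      (fun k x => (phi k x)%:E) (fun x => (\1_[set x | 0 < W x] x)%:E) (cst 1%E).
    rewrite integral_indic//; last exact: pos_measurable.
    rewrite setIT; apply.
    + by move=> n; apply/measurable_realfun.measurable_EFinP; exact: dom_measurable.
    + by move=> x _; exact: phicvg.
    + by [].
    + apply/integrableP; split; first exact: measurable_cst.
      by rewrite (eq_integral (cst 1%E)) ?integral_cst// ?mul1e// => x _; rewrite abse1.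
    + move=> n x _; have /andP[h1 h2] := phi01 n x.
      by rewrite /= lee_fin ger0_norm.
  have := key _ muoo; have := key _ nuoo.
  rewrite (_ : (fun k => \int[mu]_x (phi k x)%:E)%E = (fun k => \int[nu]_x (phi k x)%:E)%E).
    by move=> c1 c2; apply: (cvg_unique _ c2 c1); exact: ereal_hausdorff.
  by apply/funext => k; apply: H.
- by move=> _; rewrite /= /mrestr (le_lt_trans _ muoo)// le_measure ?inE//; exact: measurableI.
Unshelve. all: by end_near. Qed.

(** * Locality of energy measures *)

Context (loc : strongly_local E F).

(** If [u x <= 0] then [u < e] near [x], so [phi] and [w] vanish near [x]. Hence the closed support
    of [w] lies in [{u > 0}], where [v] is constant. *)
Lemma cutoff_local u phi w v c : F u -> cutoff u phi -> F w -> F v ->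
  (forall x, phi x = 0 -> w x = 0) -> (forall x, 0 < u x -> v x = c) ->
  E w v = 0.
Proof.
move=> Fu [Fphi _ [e e0 phi0]] Fw Fv w0 vc; apply: loc => //.
exists c, [set x | 0 < u x] => //; split.
  by apply: gt_open; exact: dom_continuous.
move=> x xw; rewrite /= ltNge; apply/negP => ux.
have [r r0 h] := dom_continuous rf _ Fu x e e0.
have [y /h xy] := xw r r0; apply; apply: w0; apply: phi0.
by move: xy; rewrite ltr_norml => /andP[]; lra.
Qed.

(** Strong locality kills [E (phi h) (h - f)] and [E phi (h^2 - f^2 - 2 k f)], whose second
    arguments equal [k] and [k^2] on [{u > 0}]. The two remaining terms [k * E phi f] cancel. *)
Lemma energy_density_local u phi h f k : F u -> cutoff u phi -> F h -> F f ->
  (forall x, 0 < u x -> h x = f x + k) ->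
  E (phi \* h) h - E phi (h \* h) / 2 = E (phi \* f) f - E phi (f \* f) / 2.
Proof.
move=> Fu cphi Fh Ff hf; have [Fphi _ [e e0 phi0]] := cphi.
have Fpf := dom_mul rf cpt _ _ Fphi Ff.
have Fhh := dom_mul rf cpt _ _ Fh Fh.
have Fff := dom_mul rf cpt _ _ Ff Ff.
have ph : phi \* h = fun x => 1 * (phi x * f x) + k * phi x.
  apply/funext => x /=; have [ux|ux] := ltP (u x) e.
    by rewrite phi0// !(mul0r, mulr0) addr0.
  by rewrite hf ?(lt_le_trans e0)//; ring.
have Fph : F (phi \* h) by rewrite ph; exact: (dom_lin rf).
have z1 : E (phi \* h) (fun x => h x - f x) = 0.
  apply: (cutoff_local u phi _ _ k Fu cphi Fph _ _ _).
  - exact: (dom_sub rf).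
  - by move=> x /= ->; rewrite mul0r.
  - by move=> x /hf ->; ring.
rewrite (form_subr rf)// in z1.
pose q x := h x * h x - f x * f x - 2 * k * f x.
have Fq1 : F (fun x => h x * h x - f x * f x) by exact: (dom_sub rf).
have Fkf : F (fun x => 2 * k * f x) by exact: (dom_scale rf).
have z2 : E phi q = 0.
  apply: (cutoff_local u phi _ _ (k ^+ 2) Fu cphi Fphi _ _ _) => //.
  - exact: (dom_sub rf).
  - by move=> x /hf hx; rewrite /q hx; ring.
rewrite /q !(form_subr rf)// in z2.
have kE : E phi (fun x => 2 * k * f x) = 2 * k * E phi f.
  rewrite (formC rf)// (_ : (fun x => _) = (fun x => 2 * k * f x + 0 * f x)); last first.
    by apply/funext => x; rewrite mul0r addr0.
  by rewrite (form_lin rf)// mul0r addr0 (formC rf).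
have pE : E (phi \* h) f = E (phi \* f) f + k * E phi f.
  by rewrite ph (form_lin rf)// mul1r.
rewrite kE in z2.
rewrite (_ : h \* h = fun x => h x * h x)// (_ : f \* f = fun x => f x * f x)//.
lra.
Qed.

Lemma energy_measure_local u h f k (mu nu : {measure set X -> \bar R}) :
  F u -> F h -> F f -> (forall x, 0 < u x -> h x = f x + k) ->
  energy_measure E F h mu -> energy_measure E F f nu ->
  forall A, measurable A -> mu (A `&` [set x | 0 < u x]) = nu (A `&` [set x | 0 < u x]).
Proof.
move=> Fu Fh Ff hf [muoo hmu] [nuoo hnu]; apply: cutoff_integral_unique => // phi cphi.
have [Fphi _ _] := cphi.
by rewrite hmu// hnu// (energy_density_local u phi h f k).
Qed.

(** * Admissible functions *)

Context {m : {measure set X -> \bar R}}.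
Context (moo : finite_measure_ m).
Context (dom : energy_dominant E F m).

Definition admissible f := F f /\ Gamma_le E F f m.

(** On [{u1 > 0}] and [{u2 > 0}] the energy measure of [h] coincides with those of [f1] and [f2].
    The rest of the space is [m]-null, hence null for the energy measure of [h] by dominance. *)
Lemma admissible_patch h f1 f2 k1 k2 u1 u2 : F h ->
  admissible f1 -> admissible f2 -> F u1 -> F u2 ->
  (forall x, 0 < u1 x -> h x = f1 x + k1) ->
  (forall x, 0 < u2 x -> h x = f2 x + k2) ->
  m [set x | u1 x <= 0 /\ u2 x <= 0] = 0%E ->
  admissible h.
Proof.
move=> Fh [Ff1 [mu1 [em1 [_ le1]]]] [Ff2 [mu2 [em2 [_ le2]]]] Fu1 Fu2 h1 h2 m0.
split => //; have [_ /(_ h Fh)[mu [emu ac]]] := dom.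
exists mu; split => //; split => // A mA.
pose U1 := [set x | 0 < u1 x]; pose U2 := [set x | 0 < u2 x].
have mU1 : measurable U1 by exact: pos_measurable.
have mU2 : measurable U2 by exact: pos_measurable.
have mB : measurable [set x | u1 x <= 0 /\ u2 x <= 0].
  rewrite (_ : mkset _ = ~` U1 `&` ~` U2); first by apply: measurableI; exact: measurableC.
  by apply/seteqP; split => x; rewrite /U1 /U2 /= => -[]; rewrite ?leNgt; split => //; apply/negP.
have l1 B : measurable B -> (mu (B `&` U1) <= m (B `&` U1))%E.
  move=> mB'; rewrite (energy_measure_local u1 h f1 k1 mu mu1)//.
  by apply: le1; exact: measurableI.
have l2 B : measurable B -> (mu (B `&` U2) <= m (B `&` U2))%E.
  move=> mB'; rewrite (energy_measure_local u2 h f2 k2 mu mu2)//.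
  by apply: le2; exact: measurableI.
have mAU : measurable (A `\` U1) by exact: measurableD.
have mu3 : mu (A `\` U1 `\` U2) = 0%E.
  apply: ac; first exact: measurableD.
  apply: subset_measure0 m0 => //; first exact: measurableD.
  by move=> x [[_ /negP + /negP]] /=; rewrite /U1 /U2 /= -!leNgt.
have split3 (l : {measure set X -> \bar R}) :
    l A = (l (A `&` U1) + (l ((A `\` U1) `&` U2) + l (A `\` U1 `\` U2)))%E.
  by rewrite (measureDI l mA mU1) addeC; congr (_ + _)%E; rewrite (measureDI l mAU mU2) addeC.
rewrite (split3 mu) (split3 m) mu3 adde0.
apply: leeD; first exact: l1.
by rewrite (le_trans (l2 _ mAU))// leeDl.
Qed.

Lemma integral_one (l : {measure set X -> \bar R}) :
  (\int[l]_x (1%R)%:E)%E = l setT.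
Proof. by rewrite (integral_cst l measurableT) mul1e. Qed.

Lemma energy_measureT f (mu : {measure set X -> \bar R}) : F f ->
  energy_measure E F f mu -> mu setT = (E f f)%:E.
Proof.
move=> Ff [_ /(_ _ (dom_cst rf 1))]; rewrite integral_one => ->.
rewrite (form_cstl rf) ?mul0r ?subr0//; last exact: (dom_mul rf cpt).
by congr (E _ _)%:E; apply/funext => x /=; rewrite mul1r.
Qed.

Lemma admissible_energy f : admissible f -> E f f <= fine (m setT).
Proof.
move=> [Ff [mu [emu [_ le]]]]; rewrite -lee_fin -(energy_measureT f mu Ff emu).
rewrite fineK; first exact: le.
by rewrite ge0_fin_numE.
Qed.

Lemma admissible_cst c : admissible (fun=> c).
Proof.
have Fc := dom_cst rf c; split => //.
have [_ /(_ _ Fc)[mu [emu ac]]] := dom.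
exists mu; split => //; split => // A mA.
have mu0 := energy_measureT _ _ Fc emu; rewrite (form_cstl rf)// in mu0.
by rewrite (le_trans _ (measure_ge0 m A))// -[leRHS]mu0 le_measure ?inE.
Qed.

Lemma admissible_shift c f : admissible f -> admissible (fun x => f x + c).
Proof.
move=> af; have [Ff _] := af; have F1 := dom_cst rf 1.
apply: (admissible_patch _ f f c c _ _ (dom_shift rf _ _ Ff) af af F1 F1) => //.
rewrite (_ : mkset _ = set0) ?measure0//.
by apply/seteqP; split => x //= -[]; rewrite leNgt ltr01.
Qed.

(** The expression defining the energy measure is quadratic in [f], so the same measure serves
    [- f]. *)
Lemma admissible_opp f : admissible f -> admissible (fun x => - f x).
Proof.
move=> [Ff [mu [[muoo emu] le]]]; split; first exact: (dom_opp rf).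
exists mu; split => //; split => // phi Fphi; rewrite emu//.
have Fpf := dom_mul rf cpt _ _ Fphi Ff.
have FN := dom_opp rf _ Ff.
have N (w : X -> R) : (fun x => - w x) = (fun x => (-1) * w x + 0 * w x).
  by apply/funext => x; ring.
have EN u v : F u -> F v -> E (fun x => - u x) v = - E u v.
  by move=> Fu Fv; rewrite N (form_lin rf)//; ring.
congr (_ - _ / _)%:E; last first.
  by congr (E _ _); apply/funext => x /=; rewrite mulrNN.
rewrite [X in _ = E X _](_ : _ = (fun x => - (phi x * f x))); last first.
  by apply/funext => x /=; rewrite mulrN.
by rewrite (EN (fun x => phi x * f x))// (formC rf _ (fun x => - f x))// EN// opprK (formC rf).
Qed.

Lemma admissible_max f g c : admissible f -> admissible g ->
  m [set x | f x - g x = c] = 0%E ->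
  admissible (fun x => Num.max (f x) (g x + c)).
Proof.
move=> af ag m0; have [Ff _] := af; have [Fg _] := ag.
have Fgc := dom_shift rf c _ Fg.
have F1 := dom_sub rf _ _ Ff Fgc; have F2 := dom_sub rf _ _ Fgc Ff.
apply: (admissible_patch _ f g 0 c _ _ (dom_max rf cpt _ _ Ff Fgc) af ag F1 F2) => /=.
- by move=> x; rewrite subr_gt0 addr0 => h; rewrite max_l// ltW.
- by move=> x; rewrite subr_gt0 => h; rewrite max_r// ltW.
rewrite (_ : mkset _ = [set x | f x - g x = c])//.
by apply/seteqP; split => x /=; lra.
Qed.

Lemma admissible_min_cst f c : admissible f -> m [set x | f x = c] = 0%E ->
  admissible (fun x => Num.min (f x) c).
Proof.
move=> af m0; have [Ff _] := af; have Fc := dom_cst rf c.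
have F1 := dom_sub rf _ _ Fc Ff; have F2 := dom_sub rf _ _ Ff Fc.
apply: (admissible_patch _ f (fun=> c) 0 0 _ _ (dom_min rf cpt _ _ Ff Fc) af
  (admissible_cst c) F1 F2) => /=.
- by move=> x; rewrite subr_gt0 addr0 => h; rewrite min_l// ltW.
- by move=> x; rewrite subr_gt0 addr0 => h; rewrite min_r// ltW.
rewrite (_ : mkset _ = [set x | f x = c])//.
by apply/seteqP; split => x /=; lra.
Qed.

(** A level of positive mass is a jump of the monotone function [c |-> m {u <= c}]. There are
    countably many jumps, and they cannot fill an interval of positive Lebesgue measure. *)
Lemma generic_level u a b : F u -> a < b ->
  exists2 c, a < c < b & m [set x | u x = c] = 0%E.
Proof.
move=> Fu ab; apply: contrapT => H.
have mle c : measurable [set x | u x <= c].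
  rewrite (_ : mkset _ = ~` [set x | c < u x]).
    by apply: measurableC; apply: open_measurable_dR; apply: gt_open; exact: dom_continuous.
  by apply/seteqP; split => x /=; rewrite leNgt => /negP.
have meq c : measurable [set x | u x = c].
  rewrite (_ : mkset _ = [set x | u x <= c] `\` [set x | u x < c]).
    apply: measurableD => //; apply: open_measurable_dR; apply: lt_open; exact: dom_continuous.
  by apply/seteqP; split => x /= => [->|[h1 /negP]]; [rewrite ltxx; split|rewrite -leNgt; lra].
have fin A : measurable A -> m A \is a fin_num.
  by move=> mA; rewrite ge0_fin_numE// (le_lt_trans _ moo)// le_measure ?inE.
pose G c := fine (m [set x | u x <= c]).
have Gm : {homo G : s t / s <= t}.
  move=> s t st; rewrite fine_le ?fin// le_measure ?inE// => x /= h.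
  exact: le_trans h st.
have Gjump s c : s < c -> G s + fine (m [set x | u x = c]) <= G c.
  move=> sc; rewrite -fineD ?fin// fine_le ?fin//.
    by rewrite fin_numD !fin.
  rewrite -measureU//.
    by apply: le_measure; rewrite ?inE//; [exact: measurableU|move=> x /= []; lra].
  by apply/seteqP; split => x //= -[]; lra.
have cnt := @discontinuity_countable R a b G (fun s t _ _ => @Gm s t).
have : lebesgue_measure (`]a, b[%classic : set R) = 0%E.
  apply: countable_lebesgue_measure0; apply: sub_countable cnt.
  apply: subset_card_le => c cab; split => //.
  have jc : 0 < fine (m [set x | u x = c]).
    rewrite lt_neqAle fine_ge0// andbT; apply/eqP => j0; apply: H; exists c.
      by move: cab; rewrite /= in_itv.
    by rewrite -[LHS]fineK ?fin// -j0.
  have cl : cvg (G x @[x --> c^'-]).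
    apply: nondecreasing_at_left_is_cvgr; near=> y.
      by move=> s t _ _; exact: Gm.
    by exists (G c) => _ [s + <-] => /itvP sc; apply: Gm; rewrite sc.
  have cr : cvg (G x @[x --> c^'+]).
    apply: nondecreasing_at_right_is_cvgr; near=> y.
      by move=> s t _ _; exact: Gm.
    by exists (G c) => _ [s + <-] => /itvP sc; apply: Gm; rewrite sc.
  split => //; rewrite lt_eqF//.
  apply: (@le_lt_trans _ _ (G c - fine (m [set x | u x = c]))).
    apply: limr_le => //; near=> y; rewrite lerBrDr; apply: Gjump.
    by near: y; exact: nbhs_left_lt.
  apply: (@lt_le_trans _ _ (G c)); first by rewrite ltrBlDr ltrDl.
  apply: limr_ge => //; near=> y; apply: Gm; apply: ltW.
  by near: y; exact: nbhs_right_gt.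
rewrite lebesgue_measure_itv/= lte_fin ab -EFinB => -[]; lra.
Unshelve. all: by end_near. Qed.

(** The uniform closure admits all maxima: the null contact set required by [admissible_max] is
    obtained by an arbitrarily small shift. *)
Definition admissible_closure u :=
  forall e, 0 < e -> exists2 f, admissible f & forall x, `|f x - u x| <= e.

Lemma admissible_closure_max u v : admissible_closure u -> admissible_closure v ->
  admissible_closure (fun x => Num.max (u x) (v x)).
Proof.
move=> hu hv e e0; have e2 : 0 < e / 2 by rewrite divr_gt0.
have [f af fu] := hu _ e2; have [g ag gv] := hv _ e2.
have [c /andP[c0 ce] mc] := generic_level _ _ _ (dom_sub rf _ _ (proj1 af) (proj1 ag)) e2.
exists (fun x => Num.max (f x) (g x + c)); first exact: admissible_max.
move=> x; move: (fu x) (gv x); rewrite !ler_norml.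
have [h1|h1] := leP (f x) (g x + c); have [h2|h2] := leP (u x) (v x); lra.
Qed.

Lemma admissible_closure_sub f : admissible f -> admissible_closure f.
Proof. by move=> af e e0; exists f => // x; rewrite subrr normr0 ltW. Qed.

Lemma admissible_closure_continuous u :
  admissible_closure u -> dR_continuous u (E := E) (F := F).
Proof.
move=> hu x e e0; have e3 : 0 < e / 3 by rewrite divr_gt0.
have [f [Ff _] fu] := hu _ e3.
have [r r0 h] := dom_continuous rf _ Ff x _ e3.
exists r => // y /h; move: (fu x) (fu y).
rewrite !ler_norml !ltr_norml; lra.
Qed.

(** * The intrinsic distance *)

Definition intrinsic_dist x y : R := fine (d_Gamma E F m x y).

Local Notation D := intrinsic_dist.
Local Notation C := (Num.sqrt (fine (m setT))).

Lemma admissible_osc f x y : admissible f ->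
  f x - f y <= res_dist x y (E := E) (F := F) * C.
Proof.
move=> af; have [Ff _] := af.
apply: le_trans (ler_norm _) _; apply: le_trans (osc_le_energy rf _ _ _ Ff) _.
by rewrite ler_wpM2l ?res_dist_ge0// ler_wsqrtr// admissible_energy.
Qed.

Lemma d_Gamma_fin x y : d_Gamma E F m x y \is a fin_num.
Proof.
rewrite fin_numElt; apply/andP; split.
  rewrite (lt_le_trans (ltNyr 0))//; apply: ereal_sup_ubound.
  by exists (fun=> 0); [exact: admissible_cst|rewrite subrr].
apply: (@le_lt_trans _ _ (res_dist x y (E := E) (F := F) * C)%:E); last exact: ltry.
by apply: ge_ereal_sup => _ [f af <-]; rewrite lee_fin admissible_osc.
Qed.

Lemma intrinsic_dist_lip x y : D x y <= res_dist x y (E := E) (F := F) * C.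
Proof.
rewrite -lee_fin /intrinsic_dist fineK ?d_Gamma_fin//.
by apply: ge_ereal_sup => _ [f af <-]; rewrite lee_fin admissible_osc.
Qed.

Lemma admissible_le_dist f x y : admissible f -> f x - f y <= D x y.
Proof.
move=> af; rewrite -lee_fin /intrinsic_dist fineK ?d_Gamma_fin//.
by apply: ereal_sup_ubound; exists f.
Qed.

Lemma intrinsic_dist_approx r x y : r < D x y -> exists2 f, admissible f & r < f x - f y.
Proof.
rewrite -lte_fin /intrinsic_dist fineK ?d_Gamma_fin// => /ereal_sup_gt[_ [f af <-]].
by rewrite lte_fin; exists f.
Qed.

Lemma intrinsic_dist_le r x y : (forall f, admissible f -> f x - f y <= r) -> D x y <= r.
Proof.
move=> h; rewrite leNgt; apply/negP => /intrinsic_dist_approx[f /h].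
by rewrite leNgt => /negP.
Qed.

Lemma intrinsic_dist_ge0 x y : 0 <= D x y.
Proof. by have := admissible_le_dist _ x y (admissible_cst 0); rewrite subrr. Qed.

Lemma intrinsic_distxx x : D x x = 0.
Proof.
apply/eqP; rewrite eq_le intrinsic_dist_ge0 andbT.
by apply: intrinsic_dist_le => f _; rewrite subrr.
Qed.

Lemma intrinsic_dist_sym x y : D x y = D y x.
Proof.
suff h a b : D a b <= D b a by apply/eqP; rewrite eq_le !h.
apply: intrinsic_dist_le => f /admissible_opp/(admissible_le_dist _ b a).
by rewrite opprK addrC.
Qed.

Lemma intrinsic_dist_triangle y x z : D x z <= D x y + D y z.
Proof.
apply: intrinsic_dist_le => f af.
by have := admissible_le_dist _ x y af; have := admissible_le_dist _ y z af; lra.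
Qed.

Lemma intrinsic_dist_continuous x : dR_continuous (D x) (E := E) (F := F).
Proof.
apply: (lipschitz_continuous rf C) => y z.
apply: le_trans (intrinsic_dist_lip y z).
have := intrinsic_dist_triangle y x z; have := intrinsic_dist_triangle z x y.
by rewrite (intrinsic_dist_sym z y) ler_norml; lra.
Qed.

(** Each [y] at distance at least [r] has an admissible function rising by more than [r - e] from
    [x] to [y]. [cover_max], applied in the uniform closure, joins these into one function, which is
    then approximated within [e]. *)
Lemma level_function x r e : 0 < e -> exists f c,
  [/\ admissible f, f x <= e, r - 3 * e < c, m [set y | f y = c] = 0%E &
      forall y, r <= D x y -> c < f y].
Proof.
move=> e0.
have [] := cover_max cpt [set u | admissible_closure u /\ u x <= 0]
  [set y | r <= D x y] (r - e).
- rewrite (_ : ~` _ = [set y | D x y < r]); first exact: lt_open (intrinsic_dist_continuous x).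
  by apply/seteqP; split => y /=; rewrite ltNge => /negP.
- by exists (fun=> 0); split => //; apply: admissible_closure_sub; exact: admissible_cst.
- by move=> u [/admissible_closure_continuous].
- move=> u v [au ux] [av vx]; split; first exact: admissible_closure_max.
  by rewrite ge_max ux vx.
- move=> y /= ry; have [|f af fxy] := intrinsic_dist_approx (r - e) y x.
    by rewrite intrinsic_dist_sym; lra.
  exists (fun z => f z + (- f x)) => //; split; last by rewrite subrr.
  by apply: admissible_closure_sub; exact: admissible_shift.
move=> u [/(_ _ e0)[f af fu] ux] hu.
(* Off the ball [f] exceeds [r - 2 * e], hence any level in this window. *)
have [|c /andP[c1 c2] mc] := generic_level f (r - 3 * e) (r - 2 * e) (proj1 af).
  by lra.
exists f, c; split => //.
  by have := fu x; rewrite ler_norml; lra.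
by move=> y /hu; have := fu y; rewrite ler_norml; lra.
Qed.

Lemma disjoint_balls x y r s : 0 < r -> 0 < s ->
  (forall z, r <= D x z \/ s <= D y z) -> r + s <= D x y.
Proof.
move=> r0 s0 hz; rewrite leNgt; apply/negP => lt.
(* The eighth pays for the losses [3 * e] in each of the levels [c], [k] and [e] in each of the
   values [f x], [g y]. *)
pose e := (r + s - D x y) / 8.
have e0 : 0 < e by rewrite divr_gt0// subr_gt0.
have [f [c [af fx rc mc hf]]] := level_function x r e e0.
have [g [k [ag gy sk mk hg]]] := level_function y s e e0.
have af' := admissible_min_cst _ _ af mc.
have ag' := admissible_min_cst _ _ ag mk.
have agN := admissible_opp _ ag'.
have [Ff _] := af; have [Fg _] := ag; have [Ff' _] := af'; have [Fg' _] := ag'.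
(* By [hz] the sets [{f > c}] and [{g > k}] cover the space; the difference is [c - min g k] on the
   first and [min f c - k] on the second. *)
have ah : admissible (fun z => Num.min (f z) c - Num.min (g z) k).
  apply: (admissible_patch _ _ _ c (- k) _ _ (dom_sub rf _ _ Ff' Fg') agN af'
    (dom_shift rf (- c) _ Ff) (dom_shift rf (- k) _ Fg)) => /=.
  - by move=> z; rewrite subr_gt0 => h; rewrite (min_r (ltW h)) addrC.
  - by move=> z; rewrite subr_gt0 => h; rewrite (min_r (ltW h)).
  rewrite (_ : mkset _ = set0) ?measure0//; apply/seteqP; split => z //= -[].
  by case: (hz z) => [/hf|/hg]; lra.
have := admissible_le_dist _ y x ah; rewrite intrinsic_dist_sym.
have -> : Num.min (f y) c = c.
  by rewrite min_r// ltW// hf//; case: (hz y) => //; rewrite intrinsic_distxx leNgt s0.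
have -> : Num.min (g x) k = k.
  by rewrite min_r// ltW// hg//; case: (hz x) => //; rewrite intrinsic_distxx leNgt r0.
have : Num.min (f x) c <= f x by rewrite ge_min lexx.
have : Num.min (g y) k <= g y by rewrite ge_min lexx.
rewrite /e in fx rc gy sk; lra.
Qed.

(** All coordinates agree at [x] and [y], hence so do their linear combinations. Approximating a
    separating [u] leaves a remainder [h] with the same difference between [x] and [y], but with too
    little energy to produce it. *)
Lemma intrinsic_dist_eq0 x y : (exists f, coordinate_sequence E F m f) -> D x y = 0 -> x = y.
Proof.
move=> [f [Ff Gf dens]] D0; apply: contrapT => xy.
have [_ _ /(_ _ _ xy)[u Fu /eqP uxy] _ _] := rf.
have fxy n : f n x = f n y.
  have an : admissible (f n) by split.
  have := admissible_le_dist _ x y an; have := admissible_le_dist _ y x an.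
  by rewrite (intrinsic_dist_sym y) D0; lra.
pose q := (u x - u y) ^+ 2.
have q0 : 0 < q by rewrite exprn_even_gt0//= subr_eq0.
have r0 : 0 < dR E F x y + 1 by rewrite ltr_wpDl// dR_ge0.
have [N [c /=]] := dens u Fu (q / (dR E F x y + 1)) (divr_gt0 q0 r0).
set h := (fun z => _ - _) => lt.
have Fh : F h.
  apply: (dom_sub rf) => //; elim: N {lt h} => [|N IH].
    rewrite (_ : (fun x => _) = fun=> 0); first exact: dom_cst rf 0.
    by apply/funext => z; rewrite big_ord0.
  rewrite (_ : (fun x => _) = fun x => (\sum_(i < N) c i * f i x) + c N * f N x).
    by apply: (dom_add rf) => //; exact: (dom_scale rf).
  by apply/funext => z; rewrite big_ord_recr.
have Eh : E h h < q / (dR E F x y + 1).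
  rewrite -lte_fin; apply: le_lt_trans lt; rewrite leeDl// integral_ge0// => z _.
  by rewrite lee_fin sqr_ge0.
have hxy : h x - h y = u x - u y.
  rewrite /h; rewrite (eq_bigr (fun i => c (nat_of_ord i) * f i y)); first by ring.
  by move=> i _; rewrite fxy.
have := sq_osc_le_energy rf _ x y Fh; rewrite hxy -/q.
rewrite ltr_pdivlMr// in Eh; have := form_ge0 rf _ Fh; nra.
Qed.

End EnergyMeasure.

(** * Geodesics and circles *)

Section Geodesic.
Context {R : realType} {T : choiceType} {E : (T -> R) -> (T -> R) -> R}
  {F : set (T -> R)} {D : T -> T -> R}.
Context (rf : resistance_form E F).
Context (cpt : dR_compact E F).
Context (metD : is_metric D).
Context (contD : forall x, dR_continuous (D x) (E := E) (F := F)).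

(** * Continuous metrics on a compact space *)

Lemma dist_ge0 x y : 0 <= D x y. Proof. by case: metD. Qed.

Lemma dist_eq0 x y : D x y = 0 <-> x = y. Proof. by case: metD. Qed.

Lemma distxx x : D x x = 0. Proof. exact/dist_eq0. Qed.

Lemma distC x y : D x y = D y x. Proof. by case: metD. Qed.

Lemma dist_triangle y x z : D x z <= D x y + D y z. Proof. by case: metD. Qed.

Lemma dist_gt0 x y : x <> y -> 0 < D x y.
Proof.
move=> xy; rewrite lt_neqAle dist_ge0 andbT eq_sym; apply/eqP => /dist_eq0; exact: xy.
Qed.

(** Every [q] is [dR]-close to [p] or at positive [D]-distance from it; compactness makes one lower
    bound serve for all [q] of the second kind. *)
Lemma dR_of_dist p e : 0 < e ->
  exists2 del, 0 < del & forall q, D p q < del -> dR E F q p < e.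
Proof.
move=> e0.
have [] := compact_nat_cover cpt
  (fun n => [set q | res_dist p q (E := E) (F := F) < Num.sqrt e] `|`
            [set q | n.+1%:R^-1 < D p q]).
- by move=> n; apply: openU; [apply: lt_open; exact: res_dist_continuous|exact: gt_open].
- move=> n k nk q [|/= h]; [by left|right => /=]; apply: le_lt_trans h.
  by rewrite lef_pV2 ?posrE ?ltr0n// ler_nat.
- move=> q; have [pq|/eqP pq] := eqVneq p q.
    by exists 0%N; left; rewrite /= pq /res_dist (dRxx rf) sqrtr0 sqrtr_gt0.
  have [n _ /(_ n (leqnn _)) h] := near_infty_natSinv_lt (PosNum (dist_gt0 _ _ pq)).
  by exists n; right.
move=> n h; exists n.+1%:R^-1; first by rewrite invr_gt0.
move=> q pq; case: (h q) => /=; last by move=> /(lt_trans pq); rewrite ltxx.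
by rewrite /res_dist ltr_sqrt// dR_sym.
Qed.

Lemma dist_of_dR p e : 0 < e ->
  exists2 r, 0 < r & forall q, dR E F q p < r -> D q p < e.
Proof.
move=> e0; have [r r0 h] := contD p p e e0; exists r => // q.
rewrite dR_sym => /h; rewrite distxx sub0r normrN distC.
by rewrite ger0_norm// dist_ge0.
Qed.

(** * Existence of geodesics *)

Context (balls : forall x y r s, 0 < r -> 0 < s ->
  (forall z, r <= D x z \/ s <= D y z) -> r + s <= D x y).

(** Otherwise every [w] is too far from [x] or from [y], by a margin that compactness makes uniform.
    Enlarged by it, the radii are positive and add up to more than [D x y], against [balls]. *)
Lemma between x y t : 0 <= t <= D x y ->
  exists2 w, D x w = t & D w y = D x y - t.
Proof.
move=> /andP[t0 tD].
have [w h1 h2] : exists2 w, D x w <= t & D w y <= D x y - t.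
  apply: contrapT => H.
  have [] := compact_nat_cover cpt
    (fun n => [set w | t + n.+1%:R^-1 < D x w] `|` [set w | D x y - t + n.+1%:R^-1 < D y w]).
  - by move=> n; apply: openU; exact: gt_open.
  - move=> n k nk w; have nk' : k.+1%:R^-1 <= n.+1%:R^-1 :> R.
      by rewrite lef_pV2 ?posrE ?ltr0n// ler_nat.
    by move=> [] /= h; [left|right] => /=; apply: le_lt_trans h; rewrite lerD2l.
  - move=> w.
    have [/= h|h] := ltP t (D x w).
      have h' : 0 < D x w - t by rewrite subr_gt0.
      have [n _ /(_ n (leqnn _)) hn] := near_infty_natSinv_lt (PosNum h').
      by exists n; left => /=; rewrite -ltrBrDl.
    have [/= k|k] := ltP (D x y - t) (D y w); last first.
      by exfalso; apply: H; exists w => //; rewrite distC.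
    have h' : 0 < D y w - (D x y - t) by rewrite subr_gt0.
    have [n _ /(_ n (leqnn _)) hn] := near_infty_natSinv_lt (PosNum h').
    by exists n; right => /=; rewrite -ltrBrDl.
  move=> n h; have n0 : 0 < n.+1%:R^-1 :> R by rewrite invr_gt0.
  have q1 : 0 < t + n.+1%:R^-1 by rewrite ltr_wpDl.
  have q2 : 0 < D x y - t + n.+1%:R^-1 by rewrite ltr_wpDl// subr_ge0.
  have := balls x y _ _ q1 q2; move: n.+1%:R^-1 n0 h {q1 q2} => q n0 h H'.
  suff : t + q + (D x y - t + q) <= D x y by lra.
  by apply: H' => z; case: (h z) => /= /ltW; [left|right].
by exists w; have := dist_triangle w x y; lra.
Qed.

(** The last clause is maximality among sets that [D x] embeds isometrically into [[0, D x y]],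
    stated for the addition of one point. *)
Definition metric_segment x y (C : set T) :=
  [/\ C x, C y, (forall p, C p -> D x p <= D x y),
      (forall p q, C p -> C q -> D p q = `|D x p - D x q|) &
      forall w, D x w <= D x y -> (forall p, C p -> D p w = `|D x p - D x w|) -> C w].

Lemma metric_segment_exists x y : exists C, metric_segment x y C.
Proof.
(* Adjoining the end points through [ext] makes the empty chain harmless in Zorn's lemma. *)
pose ext (C : set T) := C `|` [set x; y].
pose P (C : set T) := (forall p, ext C p -> D x p <= D x y) /\
  (forall p q, ext C p -> ext C q -> D p q = `|D x p - D x q|).
have [G GP totG|A [[A1 A2] maxA]] := @Zorn_bigcup T P.
  have exG p : ext (\bigcup_(C in G) C) p -> [set x; y] p \/ exists2 C, G C & C p.
    by move=> [[C GC Cp]|]; [right; exists C|left].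
  have ends p q : [set x; y] p -> [set x; y] q -> D p q = `|D x p - D x q|.
    have Dxy : `|D x y| = D x y by rewrite ger0_norm ?dist_ge0.
    by move=> [] -> [] ->; rewrite ?distxx ?subr0 ?sub0r ?normrN ?subrr ?normr0 ?Dxy// distC.
  split => [p /exG[]|p q /exG[pxy|[C GC Cp]] /exG[qxy|[C' GC' Cq]]].
  - by move=> [] ->; rewrite ?distxx ?dist_ge0.
  - by move=> [C GC Cp]; have [h _] := GP C GC; apply: h; left.
  - exact: ends.
  - by have [_ h] := GP C' GC'; apply: h; [right|left].
  - by have [_ h] := GP C GC; apply: h; [left|right].
  - have [_ h] := GP C GC; have [_ h'] := GP C' GC'.
    have [CC|CC] := totG C C' GC GC'.
      by apply: h'; left => //; exact: CC.
    by apply: h; left => //; exact: CC.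
exists (ext A); split => //; [by right; left|by right; right|].
move=> w wD wA; have [Aw|nAw] := pselect (A w); first by left.
exfalso; apply: (maxA (A `|` [set w])).
  split; first by move=> p Ap; left.
  by move=> /(_ w (or_intror erefl)).
have extw p : ext (A `|` [set w]) p -> ext A p \/ p = w.
  by move=> [[Ap|->]|pxy]; [left; left|right|left; right].
split => [p /extw[/A1//|->//]|p q /extw[Ap|->] /extw[Aq|->]].
- exact: A2.
- exact: wA.
- by rewrite distC wA// distrC.
- by rewrite distxx subrr normr0.
Qed.

Lemma metric_segment_additive x y C z : metric_segment x y C -> C z ->
  D x y = D x z + D z y.
Proof.
move=> [Cx Cy Cle Ciso _] Cz; rewrite (Ciso z y)// ler0_norm ?subr_le0 ?Cle//.
by ring.
Qed.

(** A point [w] at level [t] only has to satisfy [D p w <= |D x p - t|] for [p] in [C]. By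
    compactness finitely many [p] matter; the nearest ones below and above [t] imply the others, and
    [between] provides for these two. Maximality puts [w] in [C]. *)
Lemma metric_segment_surj x y C t : metric_segment x y C -> 0 <= t <= D x y ->
  exists2 p, C p & D x p = t.
Proof.
move=> [Cx Cy Cle Ciso Cmax] /andP[t0 tD].
have [w hw] : exists w, forall p, C p -> D p w <= `|D x p - t|.
  apply: contrapT => H.
  have [] := cpt _ (fun p => [set w | C p /\ `|D x p - t| < D p w]).
  - move=> p w /= [Cp pw]; have [r r0 h] := gt_open _ _ (contD p) w pw.
    by exists r => // v /h.
  - move=> w; apply: contrapT => nw; apply: H; exists w => p Cp.
    by rewrite leNgt; apply/negP => pw; apply: nw; exists p.
  move=> J /finite_seqP[l ->] hl.
  have [u [Cu ut] hu] : exists2 u, C u /\ D x u <= t &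
      forall q, q \in l -> C q -> D x q <= t -> D x q <= D x u.
    elim: l {hl} => [|q l [u [Cu ut] hu]]; first by exists x => //; rewrite distxx.
    have [[Cq qt uq]|nq] := pselect [/\ C q, D x q <= t & D x u <= D x q].
      exists q => // v; rewrite inE => /orP[/eqP -> //|vl Cv vt].
      exact: le_trans (hu v vl Cv vt) uq.
    exists u => // v; rewrite inE => /orP[/eqP -> Cq qt|]; last exact: hu.
    by have [//|/ltW uq] := leP (D x q) (D x u); exfalso; apply: nq.
  have [v [Cv tv] hv] : exists2 v, C v /\ t <= D x v &
      forall q, q \in l -> C q -> t <= D x q -> D x v <= D x q.
    elim: l {hl hu} => [|q l [v [Cv tv] hv]]; first by exists y.
    have [[Cq qt uq]|nq] := pselect [/\ C q, t <= D x q & D x q <= D x v].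
      exists q => // w; rewrite inE => /orP[/eqP -> //|wl Cw wt].
      exact: le_trans uq (hv w wl Cw wt).
    exists v => // w; rewrite inE => /orP[/eqP -> Cq qt|]; last exact: hv.
    by have [//|/ltW uq] := leP (D x v) (D x q); exfalso; apply: nq.
  have uv : D u v = D x v - D x u.
    by rewrite Ciso// ler0_norm ?opprB// subr_le0 (le_trans ut).
  have [|w uw wv] := between u v (t - D x u); first by rewrite uv; lra.
  have [q /= ql [Cq]] := hl w; apply/negP; rewrite -leNgt.
  have [qt|/ltW qt] := leP (D x q) t.
    rewrite ler0_norm ?subr_le0//; have := dist_triangle u q w.
    by rewrite uw (Ciso q u)// ler0_norm ?subr_le0 ?hu//; lra.
  rewrite ger0_norm ?subr_ge0//; have := dist_triangle v q w.
  by rewrite (distC v w) wv uv (Ciso q v)// ger0_norm ?subr_ge0 ?hv//; lra.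
have xw : D x w = t.
  have := hw x Cx; have := hw y Cy; have := dist_triangle w x y.
  by rewrite distxx sub0r normrN (ger0_norm t0) ger0_norm ?subr_ge0// (distC y w); lra.
exists w => //; apply: Cmax; first by rewrite xw.
move=> p Cp; apply/eqP; rewrite eq_le xw hw//= ler_norml -xw.
have := dist_triangle p x w; have := dist_triangle w x p; rewrite (distC w p); lra.
Qed.

(** The isometry relations pass to limit points, which therefore belong to [C] by maximality. *)
Lemma metric_segment_closed x y C w : metric_segment x y C -> ~ C w ->
  exists2 e, 0 < e & forall p, C p -> e <= D p w.
Proof.
move=> [Cx Cy Cle Ciso Cmax] nCw; apply: contrapT => H.
have near e : 0 < e -> exists2 p, C p & D p w < e.
  move=> e0; apply: contrapT => H'; apply: H; exists e => // p Cp.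
  by rewrite leNgt; apply/negP => pw; apply: H'; exists p.
apply: nCw; apply: Cmax => [|p Cp].
  apply/ler_addgt0Pr => e /near[q Cq qw].
  by have := dist_triangle q x w; have := Cle q Cq; lra.
apply/eqP; rewrite eq_le; apply/andP; split; last first.
  rewrite ler_norml; have := dist_triangle p x w; have := dist_triangle w x p.
  by rewrite (distC w p); lra.
apply/ler_addgt0Pr => e e0.
have [q Cq qw] := near (e / 2) (divr_gt0 e0 (ltr0n _ 2)).
have := dist_triangle q p w; rewrite (Ciso p q Cp Cq).
have := ler_distD (D x w) (D x p) (D x q).
have : `|D x w - D x q| <= D q w.
  rewrite ler_norml; have := dist_triangle q x w; have := dist_triangle w x q.
  by rewrite (distC w q); lra.
lra.
Qed.

(** * Circles made of two curves *)

Definition curve (c : R -> T) (a b : R) := forall t, a <= t <= b -> forall e, 0 < e ->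
  exists2 del, 0 < del &
    forall s, a <= s <= b -> `|s - t| < del -> D (c s) (c t) < e.

(* [s0] may lie outside [[-1, 1]], in which case the curve stays away from [w]. *)
Lemma curve_separated c w s0 e : curve c (-1) 1 ->
  (forall s, -1 <= s <= 1 -> c s = w -> s = s0) -> 0 < e ->
  exists2 eta, 0 < eta &
    forall s, -1 <= s <= 1 -> D (c s) w < eta -> `|s - s0| < e.
Proof.
(* Clamping to [[-1, 1]] extends the curve continuously to the whole line. *)
move=> cc cw e0; pose cl (s : R) := Num.max (-1) (Num.min s 1).
have cl01 s : -1 <= cl s <= 1.
  by rewrite /cl le_max lexx/= ge_max ge_min lexx orbT andbT; lra.
have clE s : -1 <= s <= 1 -> cl s = s.
  by move=> /andP[s1 s2]; rewrite /cl min_l// max_r.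
have clL s t : `|cl s - cl t| <= `|s - t|.
  have clx x : [/\ x <= -1 & cl x = -1] \/ [/\ 1 <= x & cl x = 1] \/
      [/\ -1 <= x, x <= 1 & cl x = x].
    have [x1|x1] := leP x (-1).
      by left; split => //; rewrite /cl max_l// ge_min x1.
    right; have [x2|x2] := leP 1 x.
      by left; split => //; rewrite /cl min_r// max_r//; lra.
    by right; rewrite clE; [split|]; lra.
  have := ler_norm (s - t); have := ler_norm (t - s); rewrite (distrC t s) ler_norml.
  by case: (clx s) => [[h ->]|[[h ->]|[h h' ->]]];
    case: (clx t) => [[k ->]|[[k ->]|[k k' ->]]]; lra.
(* The tent around [s0] makes the minimum of [k] positive. That minimum serves as [eta]:
   [D (c s) w < eta <= k s] forces the tent to be positive at [s]. *)
pose k s := D (c (cl s)) w + Num.max 0 (e - `|s - s0|).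
have kc : continuous k.
  move=> t; apply/cvgrPdist_lt => q q0.
  have q2 : 0 < q / 2 by rewrite divr_gt0.
  have [del del0 hdel] := cc _ (cl01 t) _ q2.
  apply/nbhs_ballP; exists (Num.min del (q / 2)); first by rewrite /= lt_min del0 q2.
  move=> s; rewrite /ball/= lt_min distrC => /andP[s1 s2].
  have h1 := hdel _ (cl01 s) (le_lt_trans (clL _ _) s1).
  have h2 : `|D (c (cl t)) w - D (c (cl s)) w| < q / 2.
    rewrite ltr_norml; have := dist_triangle (c (cl s)) (c (cl t)) w.
    by have := dist_triangle (c (cl t)) (c (cl s)) w; rewrite (distC (c (cl t)) (c (cl s))); lra.
  have h3 : `|Num.max 0 (e - `|t - s0|) - Num.max 0 (e - `|s - s0|)| <= `|s - t|.
    have h4 := ler_distD t s s0; have h5 := ler_distD s t s0; rewrite (distrC t s) in h5.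
    have [h6|h6] := leP 0 (e - `|t - s0|); have [h7|h7] := leP 0 (e - `|s - s0|);
    rewrite ler_norml; lra.
  rewrite /k; move: h2 h3; rewrite ltr_norml ler_norml ltr_norml; lra.
have N11 : -1 <= 1 :> R by lra.
have [s1 s1in hmin] := EVT_min N11 (continuous_subspaceT kc).
have s1' : -1 <= s1 <= 1 by move: s1in; rewrite in_itv.
exists (k s1).
  rewrite /k clE//; have [cs1|/eqP cs1] := eqVneq (c s1) w.
    by rewrite (cw _ s1' cs1) subrr normr0 subr0 ltr_wpDl ?dist_ge0// lt_max e0 orbT.
  by rewrite ltr_pwDl ?dist_gt0// le_max lexx.
move=> s s11 cs; have := hmin s; rewrite in_itv/= => /(_ s11).
rewrite /k (clE s)// -/(k s1) => /(lt_le_trans cs).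
by have [h|h] := leP 0 (e - `|s - s0|); lra.
Qed.

Lemma eucl_dist1 (p q : R * R) : `|q.1 - p.1| <= eucl_dist q p.
Proof. by rewrite -sqrtr_sqr ler_wsqrtr// lerDl sqr_ge0. Qed.

Lemma eucl_dist2 (p q : R * R) : `|q.2 - p.2| <= eucl_dist q p.
Proof. by rewrite -sqrtr_sqr ler_wsqrtr// lerDr sqr_ge0. Qed.

Lemma circle_fst (p : R * R) : circle p -> -1 <= p.1 <= 1.
Proof. by rewrite /circle /= => h; have := sqr_ge0 p.2; nra. Qed.

(** On one half [|q.2 - p.2| <= |q.2 + p.2|], so [(q.2 - p.2)^2 <= |q.1^2 - p.1^2| <= 2 * |q.1 -
    p.1|]. The bounds [1] and [e^2 / 4] keep the squared distance below [3 / 4 * e^2]. *)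
Lemma circle_half_dist (p q : R * R) e : circle p -> circle q -> 0 <= p.2 * q.2 ->
  0 < e -> `|q.1 - p.1| < Num.min 1 (e ^+ 2 / 4) -> eucl_dist q p < e.
Proof.
move=> cp cq pq e0; rewrite lt_min => /andP[h1 h4].
rewrite -(ger0_norm (ltW e0)) -sqrtr_sqr /eucl_dist ltr_sqrt ?exprn_gt0//.
have := circle_fst _ cp; have := circle_fst _ cq; rewrite /circle /= in cp cq.
have -> : (q.1 - p.1) ^+ 2 = `|q.1 - p.1| ^+ 2 by rewrite real_normK ?num_real.
move=> q1 p1.
have k : (q.2 - p.2) ^+ 2 <= 2 * `|q.1 - p.1|.
  have : `|q.2 - p.2| <= `|q.2 + p.2|.
    by rewrite -ler_sqr ?nnegrE// !real_normK ?num_real//; nra.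
  move=> /(ler_wpM2l (normr_ge0 (q.2 - p.2))).
  rewrite -expr2 real_normK ?num_real// -normrM => /le_trans; apply.
  rewrite (_ : _ * _ = (p.1 + q.1) * (p.1 - q.1)); last by lra.
  rewrite normrM (distrC p.1) ler_wpM2r// ler_norml; lra.
have n0 := normr_ge0 (q.1 - p.1); nra.
Qed.

Lemma half_circle_separated c w (p : R * R) (sg : R) e :
  curve c (-1) 1 -> circle p ->
  (forall s, -1 <= s <= 1 -> c s = w -> s = p.1 /\ 0 <= sg * p.2) ->
  0 < e -> sg ^+ 2 = 1 -> exists2 eta, 0 < eta &
    forall q, circle q -> 0 <= sg * q.2 -> D (c q.1) w < eta -> eucl_dist q p < e.
Proof.
move=> cc cp cw e0 sg1.
have [sp|sp] := leP 0 (sg * p.2); last first.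
  (* Here the curve misses [w]. No point of [[-1, 1]] is within [1] of [5], so the case becomes
     vacuous. *)
  have [|eta eta0 h] := curve_separated c w 5 1 cc _ ltr01.
  - by move=> s s1 /(cw s s1)[_]; rewrite leNgt sp.
  exists eta => // q cq _ /(h _ (circle_fst _ cq)).
  by have := circle_fst _ cq; rewrite ltr_norml; lra.
have e1 : 0 < Num.min 1 (e ^+ 2 / 4) by rewrite lt_min ltr01 divr_gt0 ?exprn_gt0.
have [|eta eta0 h] := curve_separated c w p.1 _ cc _ e1.
  by move=> s s1 /(cw s s1)[].
exists eta => // q cq sq /(h _ (circle_fst _ cq)) qp.
apply: circle_half_dist => //.
by have := mulr_ge0 sp sq; rewrite mulrACA -expr2 sg1 mul1r.
Qed.

(** The abscissa parametrizes both half-circles, mapped by [up] and [lo]. The combined map is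
    injective as the curves meet only over abscissas [1] and [-1]; its inverse is continuous by
    [half_circle_separated]. *)
Lemma circle_of_curves (up lo : R -> T) : curve up (-1) 1 -> curve lo (-1) 1 ->
  (forall s t, -1 <= s <= 1 -> -1 <= t <= 1 -> up s = up t -> s = t) ->
  (forall s t, -1 <= s <= 1 -> -1 <= t <= 1 -> lo s = lo t -> s = t) ->
  (forall s t, -1 <= s <= 1 -> -1 <= t <= 1 -> up s = lo t -> s = t /\ s ^+ 2 = 1) ->
  up (-1) = lo (-1) -> up 1 = lo 1 ->
  exists S, homeomorphic_to_circle E F S.
Proof.
move=> cup clo iup ilo uplo upN1 up1.
pose f (p : R * R) := if 0 <= p.2 then up p.1 else lo p.1.
have upp p : circle p -> 0 <= p.2 -> f p = up p.1 by rewrite /f => _ ->.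
have low p : circle p -> p.2 <= 0 -> f p = lo p.1.
  rewrite /f => cp p0; case: ifP => // p0'.
  have {p0 p0'} p2 : p.2 = 0 by lra.
  have : (p.1 - 1) * (p.1 + 1) = 0.
    by move: cp; rewrite /circle /= p2; lra.
  move/eqP; rewrite mulf_eq0 => /orP[] /eqP h.
    by rewrite (_ : p.1 = 1)//; lra.
  by rewrite (_ : p.1 = -1)//; lra.
have sq p q : circle p -> circle q -> p.1 = q.1 -> 0 <= p.2 * q.2 -> p = q.
  move: p q => [a b] [u v]; rewrite /circle /= => h1 h2 au h3; rewrite au in h1 *; congr pair.
  have : (b - v) * (b + v) = 0 by lra.
  move/eqP; rewrite mulf_eq0 => /orP[] /eqP h; first by lra.
  have : b = - v by lra.
  move=> hb; rewrite hb in h3 *; have : v ^+ 2 = 0.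
    by apply/eqP; rewrite eq_le sqr_ge0 andbT; lra.
  by move/eqP; rewrite sqrf_eq0 => /eqP ->; rewrite oppr0.
have finj p q : circle p -> circle q -> f p = f q -> p = q.
  move=> cp cq; have p1 := circle_fst _ cp; have q1 := circle_fst _ cq.
  have [p2|/ltW p2] := leP 0 p.2; have [q2|/ltW q2] := leP 0 q.2.
  - by rewrite !upp// => /iup h; apply: sq => //; [exact: h|exact: mulr_ge0].
  - rewrite upp// low// => /uplo -/(_ p1 q1)[h h1]; apply: sq => //.
    have : q.2 ^+ 2 = 0 by move: cq; rewrite /circle /= -h; lra.
    by move/eqP; rewrite sqrf_eq0 => /eqP ->; rewrite mulr0.
  - rewrite low// upp// => /esym/uplo -/(_ q1 p1)[h h1]; apply: sq => //.
    have : q.2 ^+ 2 = 0 by move: cq; rewrite /circle /=; lra.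
    by move/eqP; rewrite sqrf_eq0 => /eqP ->; rewrite mulr0.
  - rewrite !low// => /ilo h; apply: sq => //; [exact: h|exact: mulr_le0].
exists (f @` circle).
have /choice[g hg] : forall x, exists p, (f @` circle) x -> circle p /\ f p = x.
  move=> x; have [[p cp fp]|n] := pselect ((f @` circle) x); first by exists p.
  by exists (0, 0).
have gf p : circle p -> g (f p) = p.
  by move=> cp; have [|h1 h2] := hg (f p); [exists p|apply: finj].
exists f, g; split.
  by split => [p cp|x /hg[]|//|x /hg[]//]; first by exists p.
split => [p cp e e0|_ [p cp <-] e e0].
  have [e1 e10 he1] := dR_of_dist (f p) e e0.
  have [d1 d10 h1] := cup _ (circle_fst _ cp) _ e10.
  have [d2 d20 h2] := clo _ (circle_fst _ cp) _ e10.
  (* Off the axis, points closer to [p] than [|p.2|] lie on the same half. On the axis both curves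
     pass through [f p], and the [1] is a placeholder. *)
  pose d3 := if p.2 == 0 then 1 else `|p.2|.
  have d30 : 0 < d3 by rewrite /d3; case: eqP => // /eqP; rewrite normr_gt0.
  exists (Num.min d3 (Num.min d1 d2)); first by rewrite !lt_min d10 d20 d30.
  move=> q cq; rewrite !lt_min => /andP[q3 /andP[q1 q2]].
  have q1' := le_lt_trans (eucl_dist1 _ _) q1.
  have q2' := le_lt_trans (eucl_dist1 _ _) q2.
  have q3' := le_lt_trans (eucl_dist2 _ _) q3.
  have cq1 := circle_fst _ cq.
  apply: he1; rewrite distC; have [qs|/ltW qs] := leP 0 q.2.
    have ps : 0 <= p.2.
      rewrite leNgt; apply/negP => p0; move: q3'; rewrite /d3 lt_eqF// (ltr0_norm p0) ltr_norml.
      by lra.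
    by rewrite !upp//; exact: h1.
  have [ps|ps] := leP p.2 0; first by rewrite !low//; exact: h2.
  move: q3'; rewrite /d3 gt_eqF// (gtr0_norm ps) ltr_norml => /andP[]; lra.
have p1 := circle_fst _ cp.
have [|eta eta0 heta] := half_circle_separated up (f p) p 1 e cup cp _ e0 (expr1n _ 2).
  move=> s s1; rewrite mul1r; have [ps|ps] := leP 0 p.2.
    by rewrite upp// => /iup ->.
  rewrite low// 1?ltW// => /uplo -/(_ s1 p1)[h h1]; exfalso.
  by move: cp; rewrite /circle /= -h h1; nra.
have N1 : (-1) ^+ 2 = 1 :> R by rewrite sqrrN expr1n.
have [|eta' eta'0 heta'] := half_circle_separated lo (f p) p (-1) e clo cp _ e0 N1.
  move=> s s1; rewrite mulN1r oppr_ge0; have [ps|ps] := leP p.2 0.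
    by rewrite low// => /ilo ->.
  rewrite upp// 1?ltW// => /esym/uplo -/(_ p1 s1)[h h1]; exfalso.
  by move: cp; rewrite /circle /= h1; nra.
have [r r0 hr] := dist_of_dR (f p) (Num.min eta eta') ltac:(by rewrite lt_min eta0).
exists r => // _ [q cq <-] /hr; rewrite lt_min => /andP[h1 h2].
rewrite !gf//; have [qs|/ltW qs] := leP 0 q.2.
  by apply: heta => //; [rewrite mul1r|rewrite -upp].
by apply: heta' => //; [rewrite mulN1r oppr_ge0|rewrite -low].
Qed.

(** * Arcs stay on geodesics *)

(** The point is the supremum of the parameters satisfying [P]; openness of the complement of [P]
    puts it in [P]. *)
Lemma last_entrance (P : R -> Prop) u t : u <= t -> P u -> ~ P t ->
  (forall s, u <= s <= t -> ~ P s -> exists2 del, 0 < del &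
     forall s', u <= s' <= t -> `|s' - s| < del -> ~ P s') ->
  exists a, [/\ u <= a, a < t, P a & forall s, a < s <= t -> ~ P s].
Proof.
move=> ut Pu nPt op; pose S := [set s | u <= s <= t /\ P s].
have Su : S u by split; rewrite ?lexx.
have hS : has_sup S by split; [exists u|exists t => s [/andP[]]].
have ua : u <= sup S by apply: ub_le_sup => //; case: hS.
have at_ : sup S <= t by apply: ge_sup; [exists u|move=> s [/andP[]]].
have Pa : P (sup S).
  apply: contrapT => nPa.
  have [|del del0 h] := op (sup S) _ nPa; first by rewrite ua.
  have [s Ss hs] := sup_adherent del0 hS; have [sut Ps] := Ss.
  apply: (h s) => //; have := ub_le_sup (proj2 hS) Ss.
  by rewrite ltr_norml; lra.
exists (sup S); split => //.
  rewrite lt_neqAle at_ andbT; apply/eqP => h; apply: nPt; rewrite -h //.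
move=> s /andP[as_ st] Ps; have : S s by split => //; lra.
by move=> /(ub_le_sup (proj2 hS)); rewrite leNgt as_.
Qed.

Lemma first_exit (P : R -> Prop) u t : t <= u -> P u -> ~ P t ->
  (forall s, t <= s <= u -> ~ P s -> exists2 del, 0 < del &
     forall s', t <= s' <= u -> `|s' - s| < del -> ~ P s') ->
  exists b, [/\ b <= u, t < b, P b & forall s, t <= s < b -> ~ P s].
Proof.
move=> tu Pu nPt op.
have [|||s su nP|a [h1 h2 h3 h4]] := last_entrance (fun s => P (- s)) (- u) (- t).
- by rewrite lerN2.
- by rewrite opprK.
- by rewrite opprK.
- have [|del del0 h] := op (- s) _ nP; first by lra.
  exists del => // s' su' ss'; apply: h; first by lra.
  by rewrite -opprD normrN.
exists (- a); split => //; [lra|lra|].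
move=> s s1; have := h4 (- s); rewrite opprK; apply; lra.
Qed.

Lemma arc_sub_metric_segment x y C g t : ~ (exists S, homeomorphic_to_circle E F S) ->
  metric_segment x y C -> Defs.arc E F g x y -> 0 <= t <= 1 -> C (g t).
Proof.
move=> nocircle seg [cg ig g0 g1] /andP[t0 t1]; apply: contrapT => nCt; apply: nocircle.
have [Cx Cy Cle Ciso _] := seg.
have gc : curve g 0 1.
  move=> s s01 e e0; have [r r0 hr] := dist_of_dR (g s) e e0.
  have [del del0 h] := cg s s01 r r0; exists del => // s' s'01 ss'.
  by apply: hr; exact: h.
have {}ig s s' : 0 <= s <= 1 -> 0 <= s' <= 1 -> g s = g s' -> s = s'.
  by move=> h h'; apply: ig; rewrite in_itv.
have op s : 0 <= s <= 1 -> ~ C (g s) -> exists2 del, 0 < del &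
    forall s', 0 <= s' <= 1 -> `|s' - s| < del -> ~ C (g s').
  move=> s01 /(metric_segment_closed _ _ _ _ seg)[e e0 he].
  have [del del0 h] := gc s s01 e e0; exists del => // s' s'01 ss' /he.
  by rewrite leNgt h.
have [||s s01 nC|a [a0 at_ Ca na]] := last_entrance (fun s => C (g s)) 0 t t0.
- by rewrite g0.
- by [].
- have [|del del0 h] := op s _ nC; first by lra.
  by exists del => // s' s'01; apply: h; lra.
have [||s s01 nC|b [b1 tb Cb nb]] := first_exit (fun s => C (g s)) 1 t t1.
- by rewrite g1.
- by [].
- have [|del del0 h] := op s _ nC; first by lra.
  by exists del => // s' s'01; apply: h; lra.
(* [c] inverts [D x] on [C]; its values outside [[0, D x y]] are arbitrary. *)
have /choice[c hc] : forall r, exists p, 0 <= r <= D x y -> C p /\ D x p = r.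
  move=> r; have [r01|nr] := pselect (0 <= r <= D x y); last by exists x.
  by have [p Cp xp] := metric_segment_surj _ _ _ _ seg r01; exists p.
set u := D x (g a); set v := D x (g b).
have u01 : 0 <= u <= D x y by rewrite dist_ge0 Cle.
have v01 : 0 <= v <= D x y by rewrite dist_ge0 Cle.
have ab : 0 < D (g a) (g b).
  apply: dist_gt0 => /ig h; have : a = b by apply: h; lra.
  by lra.
rewrite Ciso// -/u -/v in ab.
(* [l] and [k] are affine on [[-1, 1]], from [u] to [v] and from [a] to [b]; [l] decreases when
   [v < u]. *)
pose l s := (u + v) / 2 + s * ((v - u) / 2).
have l01 s : -1 <= s <= 1 -> 0 <= l s <= D x y.
  by rewrite /l => s1; apply/andP; split; nra.
pose k s := (a + b) / 2 + s * ((b - a) / 2).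
have kab s : -1 <= s <= 1 -> a <= k s <= b.
  by rewrite /k => s1; apply/andP; split; nra.
(* The piece of geodesic has constant speed, whence its continuity and injectivity. *)
have lo_dist s s' : -1 <= s <= 1 -> -1 <= s' <= 1 ->
    D (c (l s)) (c (l s')) = `|s - s'| * (`|u - v| / 2).
  move=> /l01/hc[Cs Ds] /l01/hc[Cs' Ds']; rewrite Ciso// Ds Ds'.
  rewrite (_ : l s - l s' = (s - s') * ((v - u) / 2)); last by rewrite /l; ring.
  by rewrite normrM normf_div (distrC v) (ger0_norm (_ : 0 <= 2)).
have same p q : C p -> C q -> D x p = D x q -> p = q.
  by move=> Cp Cq h; apply/dist_eq0; rewrite Ciso// h subrr normr0.
have N11 : -1 <= (-1 : R) <= 1 by lra.
have P11 : -1 <= (1 : R) <= 1 by lra.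
have kN1 : k (-1) = a by rewrite /k; field.
have k1 : k 1 = b by rewrite /k; field.
have lN1 : l (-1) = u by rewrite /l; field.
have l1 : l 1 = v by rewrite /l; field.
have eN1 : g (k (-1)) = c (l (-1)).
  by rewrite kN1 lN1; have [? ?] := hc _ u01; apply: same.
have e1 : g (k 1) = c (l 1).
  by rewrite k1 l1; have [? ?] := hc _ v01; apply: same.
have clo : curve (c \o l) (-1) 1.
  move=> s s1 e e0; exists (e / (`|u - v| / 2)); first by rewrite !divr_gt0.
  by move=> s' s1'; rewrite /= lo_dist// ltr_pdivlMr// divr_gt0.
have iup s s' : -1 <= s <= 1 -> -1 <= s' <= 1 -> g (k s) = g (k s') -> s = s'.
  move=> /kab s1 /kab s1' /ig h; have : k s = k s' by apply: h; lra.
  have ba : b - a != 0 by rewrite subr_eq0 gt_eqF//; lra.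
  rewrite /k => /addrI/mulIf; apply; by rewrite mulf_neq0// invr_eq0 pnatr_eq0.
have ilo s s' : -1 <= s <= 1 -> -1 <= s' <= 1 -> c (l s) = c (l s') -> s = s'.
  move=> s1 s1' /dist_eq0; rewrite lo_dist// => /eqP.
  by rewrite mulf_eq0 (gt_eqF (divr_gt0 ab (ltr0n _ 2))) orbF normr_eq0 subr_eq0 => /eqP.
apply: (circle_of_curves (g \o k) (c \o l)) => //.
- move=> s s1 e e0; have ks := kab _ s1.
  have [|del del0 h] := gc (k s) _ e e0; first by lra.
  exists del => // s' s1' ss'; have ks' := kab _ s1'; apply: h; first by lra.
  apply: le_lt_trans ss'.
  rewrite (_ : k s' - k s = (s' - s) * ((b - a) / 2)); last by rewrite /k; ring.
  by rewrite normrM ler_piMr// ger0_norm; lra.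
(* By the choice of [a] and [b] the excursion meets [C] at its end points only. *)
- move=> s s' s1 s1' /= h.
  have Ck : C (g (k s)) by rewrite h; have [] := hc _ (l01 _ s1').
  have : k s = a \/ k s = b.
    have /andP[k1' k2'] := kab _ s1.
    have [ka|ka] := eqVneq (k s) a; first by left.
    have [kb|kb] := eqVneq (k s) b; first by right.
    have ka' : a < k s by rewrite lt_neqAle eq_sym ka.
    have kb' : k s < b by rewrite lt_neqAle kb.
    exfalso; have [kt|kt] := leP (k s) t; first by apply: (na (k s)); rewrite ?ka'.
    by apply: (nb (k s)); rewrite ?kb' ?(ltW kt).
  case => ks; [have s_ : s = -1|have s_ : s = 1].
  + by apply: iup => //; rewrite ks kN1.
  + by rewrite s_ eN1 in h; rewrite s_ sqrrN expr1n; split => //; exact: ilo h.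
  + by apply: iup => //; rewrite ks k1.
  + by rewrite s_ e1 in h; rewrite s_ expr1n; split => //; exact: ilo h.
Qed.

Lemma geodesic_dendrite : dendrite E F -> shortest_path_metric E F D.
Proof.
move=> [_ nocircle]; split => // x y z [->|[->|[g ag [t t01 <-]]]].
- by rewrite distxx add0r.
- by rewrite distxx addr0.
have [C seg] := metric_segment_exists x y.
apply: (metric_segment_additive _ _ _ _ seg).
exact: arc_sub_metric_segment seg ag t01.
Qed.

End Geodesic.

Theorem theorem3p4 (R : realType) (d : measure_display) (X : measurableType d)
    (E : (X -> R) -> (X -> R) -> R) (F : set (X -> R))
    (m : {measure set X -> \bar R}) :
  resistance_form E F ->
  strongly_local E F ->
  dR_compact E F ->
  dendrite E F ->
  borel_dR E F ->
  finite_measure_ m ->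
  energy_dominant E F m ->
  (exists f : nat -> X -> R, coordinate_sequence E F m f) ->
  (forall x y : X, d_Gamma E F m x y \is a fin_num) /\
  shortest_path_metric E F (fun x y => fine (d_Gamma E F m x y)).
Proof.
move=> rf loc cpt den bor moo dom coord.
(* Finiteness ensures that [fine] keeps the value of the supremum. *)
split; first exact: d_Gamma_fin.
apply: (@geodesic_dendrite R X E F (@intrinsic_dist R d X E F m)) => //.
- split.
  + exact: intrinsic_dist_ge0.
  + move=> x y; split => [|->]; last exact: intrinsic_distxx.
    exact: intrinsic_dist_eq0.
  + exact: intrinsic_dist_sym.
  + by move=> x y z; exact: intrinsic_dist_triangle.
- exact: intrinsic_dist_continuous.
- exact: disjoint_balls.
Qed.
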